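(* Let $(M,\omega)$ be a connected symplectic manifold (open or closed). Let $X_0,X_1,Y_0,Y_1\subset M$ be compact sets with $X_0\cap X_1=Y_0\cap Y_1=\emptyset$ and $pb_4(X_0,X_1,Y_0,Y_1)=p>0$. Let $G\in C_c^\infty(M)$ be a Hamiltonian function with $G|_{Y_0}\le 0$ and $G|_{Y_1}\ge 1$, generating the Hamiltonian flow $g_t$. Then $g_Tx\in X_1$ for some point $x\in X_0$ and some time $T\in[-1/p,1/p]$.
   Context: $C^\infty_c(M)$ is the space of smooth compactly supported real functions on $M$ with the norm $\|F\|=\max_M|F|$. The Hamiltonian vector field of $F$ is given by $i_{\mathrm{sgrad}F}\,\omega=-dF$, the Hamiltonian flow is the flow of this field, and $\{F,G\}=\omega(\mathrm{sgrad}\,G,\mathrm{sgrad}\,F)$. For compact $X_0,X_1,Y_0,Y_1$ with $X_0\cap X_1=Y_0\cap Y_1=\emptyset$, $pb_4(X_0,X_1,Y_0,Y_1)=\inf\|\{F,G\}\|$ over all $F,G\in C_c^\infty(M)$ with $F|_{X_0}\le 0$, $F|_{X_1}\ge 1$, $G|_{Y_0}\le 0$, $G|_{Y_1}\ge 1$. *)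

(* Defs.v *)
From HB Require Import structures.
From mathcomp Require Import all_boot all_order all_algebra.
From mathcomp Require Import all_classical all_reals all_analysis.

Set Implicit Arguments.
Unset Strict Implicit.
Unset Printing Implicit Defensive.

Import Order.TTheory GRing.Theory Num.Theory.
Import numFieldNormedType.Exports.

Local Open Scope classical_set_scope.
Local Open Scope ring_scope.

Section Smooth.
Context {R : realType} {d : nat} {W : normedModType R}.

Definition basis_vec (i : 'I_d) : 'rV[R]_d := delta_mx 0 i.

Fixpoint iter_partial (s : seq 'I_d) (f : 'rV[R]_d -> W) : 'rV[R]_d -> W :=
  if s is i :: s' then fun y => 'D_(basis_vec i) (iter_partial s' f) y else f.

(* C^oo on U (used for open U only): the iterated partial derivatives of all
   orders exist and are continuous at every point of U. *)
Definition smooth_on (U : set 'rV[R]_d) (f : 'rV[R]_d -> W) : Prop :=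
  forall (s : seq 'I_d) (y : 'rV[R]_d), U y ->
    {for y, continuous (iter_partial s f)} /\
    forall i : 'I_d, derivable (iter_partial s f) y (basis_vec i).

End Smooth.

(* A homeomorphism from an open subset of M onto an open subset of R^d; the
   values of cmap outside cdom and of cinv outside the image are irrelevant. *)
Record chart (R : realType) (d : nat) (M : topologicalType) := Chart {
  cdom : set M;
  cmap : M -> 'rV[R]_d;
  cinv : 'rV[R]_d -> M;
  cdom_open : open cdom;
  cimg_open : open (cmap @` cdom);
  cmapK : forall x, cdom x -> cinv (cmap x) = x;
  cmap_continuous : forall x, cdom x -> {for x, continuous cmap};
  cinv_continuous : forall y, (cmap @` cdom) y -> {for y, continuous cinv}
}.

Definition cimg (R : realType) (d : nat) (M : topologicalType)
  (c : chart R d M) : set 'rV[R]_d := cmap c @` cdom c.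

(* A smooth manifold structure without boundary on M. The chart [chart_at x]
   around x serves to coordinatize the tangent space at x. *)
Record manifold (R : realType) (d : nat) (M : topologicalType) := Manifold {
  manifold_hausdorff : hausdorff_space M;
  manifold_second_countable : @second_countable M;
  atlas : set (chart R d M);
  chart_at : M -> chart R d M;
  chart_at_atlas : forall x, atlas (chart_at x);
  mem_chart_at : forall x, cdom (chart_at x) x;
  atlas_compatible : forall c c', atlas c -> atlas c' ->
    smooth_on (cmap c @` (cdom c `&` cdom c')) (cmap c' \o cinv c)
}.

Section Manifold.
Context {R : realType} {d : nat} {M : topologicalType} (A : manifold R d M).

(* T_x M is R^d: a tangent vector at x is given by its components in the chart
   [chart_at A x], which depends on x. *)
Definition tangent (x : M) : Type := 'rV[R]_d.

(* The coordinate vector d/dy_i of the chart c at the point with c-coordinates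
   y, as an element of the tangent space at that point. *)
Definition coord_vec (c : chart R d M) (y : 'rV[R]_d) (i : 'I_d) :
    tangent (cinv c y) :=
  'D_(basis_vec i) (cmap (chart_at A (cinv c y)) \o cinv c) y.

Definition smooth (F : M -> R) : Prop :=
  forall c, atlas A c -> smooth_on (cimg c) (F \o cinv c : 'rV[R]_d -> R).

Definition smooth_compact_support (F : M -> R) : Prop :=
  smooth F /\ compact (closure [set x | F x != 0]).

Definition differential (F : M -> R) (x : M) (v : tangent x) : R :=
  'D_v (F \o cinv (chart_at A x) : 'rV[R]_d -> R) (cmap (chart_at A x) x).

(* An integral curve is required to be continuous since cmap is arbitrary
   outside the domain of the chart. *)
Definition is_flow (X : forall x : M, tangent x) (g : R -> M -> M) : Prop :=
  forall x : M,
    [/\ g 0 x = x,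
        continuous (fun t : R => g t x)
      & forall t : R, is_derive t (1 : R)
          (fun s : R => cmap (chart_at A (g t x)) (g s x)) (X (g t x))].

(* A field of bilinear forms, given by its Gram matrices. *)
Definition bilin_field : Type := M -> 'M[R]_d.

Definition form (w : bilin_field) (x : M) (u v : tangent x) : R :=
  ((u : 'rV[R]_d) *m w x *m (v : 'rV[R]_d)^T) 0 0.

Definition form_coord (w : bilin_field) (c : chart R d M) (i j : 'I_d)
    (y : 'rV[R]_d) : R :=
  form w (coord_vec c y i) (coord_vec c y j).

Record symplectic (w : bilin_field) : Prop := Symplectic {
  symplectic_smooth : forall c, atlas A c -> forall i j,
    smooth_on (cimg c) (form_coord w c i j);
  symplectic_skew : forall x (u v : tangent x), form w u v = - form w v u;
  symplectic_nondeg : forall x (u : tangent x),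
    (forall v : tangent x, form w u v = 0) -> u = (0 : 'rV[R]_d);
  (* dw (d/dy_i, d/dy_j, d/dy_k) = 0 *)
  symplectic_closed : forall c, atlas A c -> forall i j k y, cimg c y ->
    'D_(basis_vec i) (form_coord w c j k) y +
    'D_(basis_vec j) (form_coord w c k i) y +
    'D_(basis_vec k) (form_coord w c i j) y = 0
}.

(* The vector X with w(X, .) = - dF; it exists and is unique as w is
   nondegenerate. *)
Definition sgrad (w : bilin_field) (F : M -> R) (x : M) : tangent x :=
  xget (0 : 'rV[R]_d)
    [set X : 'rV[R]_d | forall v : tangent x,
       form w (X : tangent x) v = - differential F v].

Definition poisson (w : bilin_field) (F G : M -> R) (x : M) : R :=
  form w (sgrad w G x) (sgrad w F x).

(* Taken in the extended reals, so that it needs no boundedness hypothesis;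
   it is a maximum for F continuous with compact support. *)
Definition unorm (F : M -> R) : \bar R :=
  ereal_sup (range (fun x => (`|F x|)%:E)).

Definition pb4 (w : bilin_field) (X0 X1 Y0 Y1 : set M) : \bar R :=
  ereal_inf [set e | exists F G : M -> R,
    [/\ smooth_compact_support F /\ smooth_compact_support G,
        (forall x, X0 x -> F x <= 0) /\ (forall x, X1 x -> 1 <= F x),
        (forall x, Y0 x -> G x <= 0) /\ (forall x, Y1 x -> 1 <= G x)
      & e = unorm (poisson w F G)]].

End Manifold.

(* Main.v *)
Require Import Defs.
From HB Require Import structures.
From mathcomp Require Import all_boot all_order all_algebra.
From mathcomp Require Import perm finmap.
From mathcomp Require Import all_classical all_reals all_analysis.
From mathcomp Require Import ring lra.

Set Implicit Arguments.
Unset Strict Implicit.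
Unset Printing Implicit Defensive.

Import Order.TTheory GRing.Theory Num.Theory.
Import numFieldNormedType.Exports.

Local Open Scope classical_set_scope.
Local Open Scope ring_scope.

(** Suppose that no trajectory of the flow [g] of [G] runs from [X0] to [X1] in
time at most [1/p]; by compactness this remains true up to some time [T > 1/p].
We construct [F] with [F <= 0] on [X0], [F >= 1] on [X1] and [|{F,G}| < p],
where [{F,G}] is the derivative of [F] along [g]; this contradicts [pb4 = p].

Averaging a cutoff function along the flow would give such an [F], but its
smoothness requires the smooth dependence of the flow on initial conditions. The
following route only needs Gronwall's inequality. Let [f_k] be finitely many
compactly supported smooth functions embedding a neighbourhood of
[supp G `|` X1] into a Euclidean space, and [rho x y = sum_k |f_k x - f_k y|].
The derivatives of the [f_k] along [g] are [rho]-Lipschitz, hence so is each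
[g_t]. The value function
  [V x = min (1, inf_(t, z in X1) |t|/T + C rho (g_t x) z)]
is [0] on [X1], [1] on [X0] (for [C] large), [rho]-Lipschitz, and
[|t|/T]-Lipschitz along the flow. Its inf-convolution
  [inf_y V y + sum_k (f_k y - f_k x)^2 / (2 eps)]
is uniformly close to [V] and its derivative along the flow is at most
[1/T + o(1)]: at a minimizer [y], compare with the values at [g_s y]. Replacing the
infimum by a soft minimum over a finite net of points [y] makes it smooth. *)

(** * Smooth functions on open sets of a Euclidean space *)

(** The infimum defining [pb4] admits only smooth functions, whereas a function built from travel
    times is at best Lipschitz. Only the derivative along [g] must stay below [p], so the smoothing
    may lose control of the derivatives in other directions. The delicate point: the derivative of
    the inf-convolution at [x] involves the velocities [f' k x], while the comparison at a minimizer
    [y] controls the same expression with [f' k y]. As [f' k] is Lipschitz, the exchange costs a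
    multiple of [rho y x ^+ 2 / eps]; as the value function is Lipschitz, a minimizer has
    [rho y x = O(eps)], so the error is [O(eps)]. This is why all Lipschitz bounds refer to one
    distance [rho], and why the [f k] are functions on all of [M]: no chart has to follow a
    trajectory. The margin between [1/T] and [p] absorbs every error. Compact support comes from a
    cutoff equal to 1 near the support of [G]; off that support the bracket vanishes anyway, so the
    cutoff does not affect the bound. *)

Section Ck.
Context {R : realType} {d : nat} {W : normedModType R}.
Implicit Types (U V : set 'rV[R]_d) (f g : 'rV[R]_d -> W).

(** Finite-order form of [smooth_on] that peels off the innermost derivative, so that the product
    and chain rules for ['D_(basis_vec i) f] feed an induction on [n]. *)
Fixpoint Ck (n : nat) U f : Prop :=
  (forall y, U y -> {for y, continuous f}) /\
  if n is m.+1 then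
    forall i, (forall y, U y -> derivable f y (basis_vec i)) /\
              Ck m U ('D_(basis_vec i) f)
  else True.

Lemma CkS n U f : Ck n.+1 U f -> Ck n U f.
Proof.
elim: n f => [|n IH] f; first by case.
by move=> [cf df]; split=> // i; have [? /IH] := df i.
Qed.

Lemma near_open U (P : 'rV[R]_d -> Prop) y :
  open U -> U y -> (forall z, U z -> P z) -> \forall z \near y, P z.
Proof. by move=> oU Uy UP; apply: filterS (open_nbhs_nbhs (conj oU Uy)). Qed.

Lemma eq_for_continuous (T : topologicalType) (T' : nbhsType) (f g : T -> T') x :
  (\forall z \near x, f z = g z) -> {for x, continuous f} ->
  {for x, continuous g}.
Proof.
move=> fg cf; have fx := nbhs_singleton fg; change (g @ x --> g x); rewrite -fx.
exact: (cvg_trans (near_eq_cvg fg) cf).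
Qed.

Lemma eq_Ck n U f g : open U -> (forall y, U y -> f y = g y) ->
  Ck n U f -> Ck n U g.
Proof.
move=> oU; elim: n f g => [|n IH] f g fg [cf df].
  split=> // y Uy; apply: (eq_for_continuous _ (cf _ Uy)).
  exact: (near_open oU Uy).
split=> [y Uy|i].
  by apply: (eq_for_continuous _ (cf _ Uy)); exact: (near_open oU Uy).
have [df1 df2] := df i; split=> [y Uy|].
  apply: near_eq_derivable (df1 _ Uy); exact: (near_open oU Uy).
apply: IH df2 => y Uy; apply: near_eq_derive; exact: (near_open oU Uy).
Qed.

Lemma iter_partial_rcons s i f :
  iter_partial (rcons s i) f = iter_partial s ('D_(basis_vec i) f).
Proof. by elim: s => //= j s ->. Qed.

Lemma smooth_onP U f : smooth_on U f <-> forall n, Ck n U f.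
Proof.
split=> [sf n|Cf s].
  elim: n f sf => [|n IH] f sf; first by split=> // y Uy; have [] := sf [::] y Uy.
  split=> [y Uy|i]; first by have [] := sf [::] y Uy.
  split=> [y Uy|]; first by have [_] := sf [::] y Uy; apply.
  by apply: IH => s y Uy; have := sf (rcons s i) y Uy; rewrite iter_partial_rcons.
elim/last_ind: s f Cf => [|s i IH] f Cf y Uy.
  by have [cf df] := Cf 1%N; split=> [|i]; [exact: cf|have [H _] := df i; exact: H].
by rewrite iter_partial_rcons; apply: IH => // n; have [_ /(_ i)[]] := Cf n.+1.
Qed.

Lemma smooth_on_cont U f y : smooth_on U f -> U y -> {for y, continuous f}.
Proof. by move=> sf Uy; have [] := sf [::] y Uy. Qed.

Lemma smooth_on_derivable U f y i :
  smooth_on U f -> U y -> derivable f y (basis_vec i).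
Proof. by move=> sf Uy; have [_] := sf [::] y Uy; apply. Qed.

Lemma smooth_on_derive U f i : smooth_on U f -> smooth_on U ('D_(basis_vec i) f).
Proof.
by move=> /smooth_onP Cf; apply/smooth_onP => n; have [_ /(_ i)[]] := Cf n.+1.
Qed.

Lemma eq_smooth_on U f g : open U -> (forall y, U y -> f y = g y) ->
  smooth_on U f -> smooth_on U g.
Proof. by move=> oU fg /smooth_onP Cf; apply/smooth_onP=> n; apply: eq_Ck fg _. Qed.

Lemma smooth_on_local U f :
  (forall y, U y -> exists V, V y /\ smooth_on V f) -> smooth_on U f.
Proof. by move=> h s y Uy; have [V [Vy sV]] := h y Uy; exact: sV. Qed.

Lemma smooth_on_cst U (c : W) : smooth_on U (fun=> c).
Proof.
apply/smooth_onP => n; elim: n c => [|n IH] c; first by split=> // y _; exact: cst_continuous.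
split=> [y _|i]; first exact: cst_continuous.
split=> [y _|]; first exact: derivable_cst.
suff -> : 'D_(basis_vec i) (fun=> c) = (fun=> 0) by [].
by apply/funext => y; exact: derive_cst.
Qed.

Lemma CkD n U f g : open U ->
  Ck n U f -> Ck n U g -> Ck n U (fun y => f y + g y).
Proof.
move=> oU; elim: n f g => [|n IH] f g Cf Cg.
  by split=> // y Uy; apply: (@continuousD R); [exact: Cf.1|exact: Cg.1].
split=> [y Uy|i].
  by apply: (@continuousD R); [exact: Cf.1|exact: Cg.1].
have [df Cdf] := Cf.2 i; have [dg Cdg] := Cg.2 i.
split=> [y Uy|]; first by apply: derivableD; [exact: df|exact: dg].
apply: eq_Ck (IH _ _ Cdf Cdg) => // y Uy.
by rewrite -deriveD //; [exact: df|exact: dg].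
Qed.

Lemma smooth_onD U f g : open U ->
  smooth_on U f -> smooth_on U g -> smooth_on U (fun y => f y + g y).
Proof.
by move=> oU /smooth_onP Cf /smooth_onP Cg; apply/smooth_onP => n; exact: CkD.
Qed.

End Ck.

(** * Products and one-variable compositions of smooth functions *)

Section SmoothScalar.
Context {R : realType} {d : nat}.
Implicit Types (U V : set 'rV[R]_d) (f g : 'rV[R]_d -> R).

(** On the line [h |-> h *: v + y] this is the one-variable chain rule, so a directional derivative
    of [f] suffices. *)
Lemma is_derive_comp1 (V : normedModType R) (s : R -> R) (f : V -> R) y v a b :
  is_derive (f y) 1 s a -> is_derive y v f b -> is_derive y v (s \o f) (a * b).
Proof.
move=> ds df.
have lineE (u : V -> R) : 'D_v u y = 'D_1 (fun h : R => u (h *: v + y)) 0.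
  rewrite /derive; set g1 := fun h : R => h^-1 *: _.
  set g2 := fun h : R => h^-1 *: _; suff -> : g1 = g2 by [].
  by apply/funext => h; rewrite /g1 /g2 /= addr0 scale0r add0r [_%:A]mulr1.
have h0 : is_derive (0 : R) 1 (fun h : R => f (h *: v + y)) b.
  by case: df => /derivable1P df1 <-; split; last rewrite lineE.
have ds' : is_derive (f ((0 : R) *: v + y)) 1 s a by rewrite scale0r add0r.
have [H1 H2] := @is_derive1_comp R s (fun h : R => f (h *: v + y)) 0 _ _ ds' h0.
by split; [apply/derivable1P|rewrite lineE].
Qed.

Lemma CkM n U f g : open U ->
  Ck n U f -> Ck n U g -> Ck n U (fun y => f y * g y).
Proof.
move=> oU; elim: n f g => [|n IH] f g Cf Cg.
  by split=> // y Uy; apply: continuousM; [exact: Cf.1|exact: Cg.1].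
split=> [y Uy|i].
  by apply: continuousM; [exact: Cf.1|exact: Cg.1].
have [df Cdf] := Cf.2 i; have [dg Cdg] := Cg.2 i.
split=> [y Uy|]; first by apply: derivableM; [exact: df|exact: dg].
apply: (eq_Ck oU _ (CkD oU (IH _ _ Cdg (CkS Cf)) (IH _ _ Cdf (CkS Cg)))) => y Uy.
have -> : (fun y => f y * g y) = f * g by [].
rewrite deriveM; [|exact: df|exact: dg].
rewrite /GRing.scale /=; ring.
Qed.

Lemma smooth_onM U f g : open U ->
  smooth_on U f -> smooth_on U g -> smooth_on U (fun y => f y * g y).
Proof.
by move=> oU /smooth_onP Cf /smooth_onP Cg; apply/smooth_onP => n; exact: CkM.
Qed.

(* A family of one-variable functions stable, up to sums and products, under
   differentiation composes with smooth functions. *)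
Lemma smooth_on_comp1 (T : Type) (s : T -> R -> R) (ds : T -> R -> R)
    (D : set R) U f (oU : open U) (fD : forall y, U y -> D (f y))
    (hs : forall t x, D x -> is_derive x 1 (s t) (ds t x))
    (hds : forall n, (forall t, Ck n U (fun y => s t (f y))) -> Ck n U f ->
       forall t, Ck n U (fun y => ds t (f y))) :
  smooth_on U f -> forall t, smooth_on U (fun y => s t (f y)).
Proof.
move=> /smooth_onP Cf t; apply/smooth_onP => n; elim: n t => [|n IH] t.
  split=> // y Uy; apply: continuous_comp; first exact: (Cf 0%N).1.
  apply/differentiable_continuous/derivable1_diffP.
  by have [] := hs t _ (fD _ Uy).
split=> [y Uy|i].
  apply: continuous_comp; first exact: (Cf 0%N).1.
  apply/differentiable_continuous/derivable1_diffP.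
  by have [] := hs t _ (fD _ Uy).
have [df Cdf] := (Cf n.+1).2 i.
have dE y : U y -> is_derive y (basis_vec i) (s t \o f)
    (ds t (f y) * 'D_(basis_vec i) f y).
  move=> Uy; apply: is_derive_comp1; first exact: (hs t _ (fD _ Uy)).
  by apply: derivableP; exact: df.
split=> [y Uy|]; first by have [] := dE y Uy.
apply: (@eq_Ck _ _ _ n U (fun y => ds t (f y) * 'D_(basis_vec i) f y)) => //.
  by move=> y Uy; rewrite -[LHS](@derive_val _ _ _ _ _ _ _ (dE y Uy)).
by apply: CkM => //; exact: hds.
Qed.

Lemma smooth_onN U f : open U -> smooth_on U f -> smooth_on U (fun y => - f y).
Proof.
move=> oU sf.
have E y : U y -> -1 * f y = - f y by rewrite mulN1r.
apply: (@eq_smooth_on R d R U (fun y => -1 * f y) _ oU E).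
exact: (@smooth_onM U (fun=> -1) f oU (@smooth_on_cst R d R U (-1)) sf).
Qed.

Lemma smooth_on_sum (I : Type) (r : seq I) (F : I -> 'rV[R]_d -> R) U : open U ->
  (forall i, smooth_on U (F i)) -> smooth_on U (fun y => \sum_(i <- r) F i y).
Proof.
move=> oU sF; elim: r => [|i r IH].
  have E y : U y -> 0 = \sum_(i <- [::]) F i y by rewrite big_nil.
  exact: (@eq_smooth_on R d R U (fun=> 0) _ oU E (smooth_on_cst _)).
have E y : U y -> F i y + \sum_(j <- r) F j y = \sum_(j <- i :: r) F j y.
  by rewrite big_cons.
apply: (@eq_smooth_on R d R U (fun y => F i y + \sum_(j <- r) F j y) _ oU E).
exact: (@smooth_onD _ _ _ U (F i) _ oU (sF i) IH).
Qed.

Lemma smooth_on_prod (I : Type) (r : seq I) (F : I -> 'rV[R]_d -> R) U : open U ->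
  (forall i, smooth_on U (F i)) -> smooth_on U (fun y => \prod_(i <- r) F i y).
Proof.
move=> oU sF; elim: r => [|i r IH].
  have E y : U y -> 1 = \prod_(i <- [::]) F i y by rewrite big_nil.
  exact: (@eq_smooth_on R d R U (fun=> 1) _ oU E (smooth_on_cst _)).
have E y : U y -> F i y * \prod_(j <- r) F j y = \prod_(j <- i :: r) F j y.
  by rewrite big_cons.
apply: (@eq_smooth_on R d R U (fun y => F i y * \prod_(j <- r) F j y) _ oU E).
exact: (@smooth_onM U (F i) _ oU (sF i) IH).
Qed.

Lemma smooth_on_expR U f : open U -> smooth_on U f ->
  smooth_on U (fun y => expR (f y)).
Proof.
move=> oU sf.
exact: (@smooth_on_comp1 unit (fun=> expR) (fun=> expR) setT U f oU _ _ _ sf tt).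
Qed.

Lemma smooth_on_inv U f : open U -> (forall y, U y -> f y != 0) ->
  smooth_on U f -> smooth_on U (fun y => (f y)^-1).
Proof.
move=> oU f0 sf.
(* A one-member family is enough: the derivative of [x^-1] is minus its own square. *)
apply: (@smooth_on_comp1 unit (fun _ x => x^-1) (fun _ x => (-1) * (x^-1 * x^-1))
  [set x | x != 0] U f oU f0 _ _ sf tt) => [_ x /= x0|n h _ t].
  have := @is_deriveV R id x 1 1 x0 (is_derive_id x 1).
  move=> h; apply: (is_derive_eq h).
  by rewrite /GRing.scale /= mulr1 -expr2 exprVn mulN1r.
have hc := (smooth_onP U (fun=> - 1 : R)).1 (smooth_on_cst (U := U) _) n.
exact: (CkM oU hc (CkM oU (h tt) (h tt))).
Qed.

Lemma smooth_on_ln U f : open U -> (forall y, U y -> 0 < f y) ->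
  smooth_on U f -> smooth_on U (fun y => ln (f y)).
Proof.
move=> oU f0 sf.
have dln (t : unit) x : [set x : R | 0 < x] x -> is_derive x 1 (@ln R) x^-1.
  exact: is_derive1_ln.
apply: (@smooth_on_comp1 unit (fun=> @ln R) (fun _ x => x^-1)
  [set x | 0 < x] U f oU f0 dln _ sf tt) => n _ _ _.
have : smooth_on U (fun y => (f y)^-1).
  by apply: smooth_on_inv => // y /f0 /gt_eqF ->.
by move=> /smooth_onP.
Qed.

(* [flat 0] is the standard function exp(-1/x) extended by 0; the other members
   of the family occur in its derivatives. *)
Definition flat (m : nat) (x : R) : R :=
  if 0 < x then x^-1 ^+ m * expR (- x^-1) else 0.

(** Comes from the term of order [m + 2] in the series of [exp (1/x)]. A quadratic bound makes every
    member of the family differentiable at 0, with derivative 0. *)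
Lemma flat_bound m (x : R) : `|flat m x| <= (m.+2)`!%:R * x ^+ 2.
Proof.
rewrite /flat; case: ifPn => [x0|_]; last by rewrite normr0 mulr_ge0 // sqr_ge0.
have xi0 : 0 < x^-1 by rewrite invr_gt0.
rewrite ger0_norm; last by rewrite mulr_ge0 ?expR_ge0 ?exprn_ge0 // ltW.
have := @expR_ge1Dxn R x^-1 m.+1 (ltW xi0).
set N := (_`!%:R) => h.
have N0 : 0 < N :> R by rewrite ltr0n fact_gt0.
have {}h : x^-1 ^+ m.+2 / N <= expR x^-1 by apply: le_trans h; rewrite lerDr ler01.
rewrite expRN ler_pdivrMr ?expR_gt0 //.
have -> : x^-1 ^+ m = N * x ^+ 2 * (x^-1 ^+ m.+2 / N).
  by rewrite !exprS expr0; field; rewrite !gt_eqF.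
by apply: ler_wpM2l => //; rewrite mulr_ge0 ?sqr_ge0 // ltW.
Qed.

Lemma is_derive_flat m (x : R) :
  is_derive x 1 (flat m) (flat m.+2 x - m%:R * flat m.+1 x).
Proof.
have [x0|x0|->] := ltgtP x 0.
- have -> : flat m.+2 x - m%:R * flat m.+1 x = 0.
    by rewrite /flat ltNge ltW //= mulr0 subr0.
  have e : \forall z \near x, 0 = flat m z.
    near=> z; rewrite /flat ifF //; apply/negbTE; rewrite -leNgt ltW //.
    by near: z; exact: lt_nbhsl.
  exact: near_eq_is_derive e (is_derive_cst _ _ _).
- apply: (@near_eq_is_derive R R R (fun x => x^-1 ^+ m * expR (- x^-1))).
    near=> z; rewrite /flat ifT //.
    by near: z; exact: lt_nbhsr.
  have x0' : x != 0 by rewrite gt_eqF.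
  have dV : is_derive x 1 (fun x : R => x^-1) (- x^-1 ^+ 2).
    have := @is_deriveV R id x 1 1 x0' (is_derive_id x 1).
    by move=> h; apply: (is_derive_eq h); rewrite /GRing.scale /= mulr1 exprVn.
  have dE : is_derive x 1 (fun x : R => expR (- x^-1)) (expR (- x^-1) * x^-1 ^+ 2).
    apply: (@is_derive1_comp R expR (fun x => - x^-1)).
    have := @is_deriveN _ _ _ _ x 1 _ dV.
    by move=> h; apply: (is_derive_eq h); rewrite opprK.
  have dP : is_derive x 1 (fun x : R => x^-1 ^+ m) (- m%:R * x^-1 ^+ m.+1).
    have -> : (fun x : R => x^-1 ^+ m) = (fun x : R => x^-1) ^+ m.
      by apply/funext => z; rewrite exprfctE.
    have := @is_deriveX _ _ _ m x 1 _ dV.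
    move=> h; apply: (is_derive_eq h); rewrite /GRing.scale /=.
    case: (m) => [|k]; first by rewrite !mul0r oppr0 mul0r.
    by rewrite !exprS expr0 /=; ring.
  have := @is_deriveM _ _ _ _ x 1 _ _ dP dE.
  move=> h; apply: (is_derive_eq h); rewrite /flat x0 /GRing.scale /= !exprS; ring.
- have -> : flat m.+2 0 - m%:R * flat m.+1 0 = 0.
    by rewrite /flat ltxx mulr0 subr0.
  have cv : (fun h : R => h^-1 *: (flat m (h *: 1 + 0) - flat m 0)) @ 0^' --> (0 : R).
    apply/cvgrPdist_le => e e0.
    have e0' : 0 < ((m.+2)`!%:R)^-1 * e :> R.
      by rewrite mulr_gt0 // invr_gt0 ltr0n fact_gt0.
    near=> h.
    have h0 : h != 0 by near: h; exact: nbhs_dnbhs_neq.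
    rewrite sub0r normrN addr0 [h *: 1]mulr1 [X in _ - X]/flat ltxx subr0.
    rewrite /GRing.scale /= normrM normfV ler_pdivrMl ?normr_gt0 //.
    apply: le_trans (flat_bound m h) _.
    rewrite -real_normK ?num_real // expr2 mulrA [leRHS]mulrC ler_wpM2r //.
    rewrite -ler_pdivlMl ?ltr0n ?fact_gt0 //.
    by near: h; apply: dnbhs0_le.
  by split; [apply/cvg_ex; exists 0|apply: cvg_lim].
Unshelve. all: by end_near. Qed.

Lemma smooth_on_flat U f : open U -> smooth_on U f ->
  smooth_on U (fun y => flat 0 (f y)).
Proof.
move=> oU sf.
apply: (@smooth_on_comp1 nat flat (fun m x => flat m.+2 x + (- m%:R) * flat m.+1 x)
  setT U f oU _ _ _ sf 0%N) => // [m x _|n h _ m].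
  by apply: is_derive_eq; first exact: is_derive_flat; rewrite mulNr.
have hc := (smooth_onP U (fun=> - m%:R : R)).1 (smooth_on_cst (U := U) _) n.
exact: CkD oU (h m.+2) (CkM oU hc (h m.+1)).
Qed.

End SmoothScalar.

(** * Continuous differentiability *)

Lemma MVT_unordered (R : realType) (f df : R -> R) (a b : R) :
  (forall x, Num.min a b <= x <= Num.max a b -> is_derive x 1 f (df x)) ->
  exists2 c, Num.min a b <= c <= Num.max a b & f b - f a = df c * (b - a).
Proof.
move=> h.
have key (u v : R) : u <= v -> (forall x : R, u <= x <= v -> is_derive x 1 f (df x)) ->
    exists2 c, u <= c <= v & f v - f u = df c * (v - u).
  move=> uv h'.
  have hc : {within `[u, v], continuous f}.
    apply: continuous_in_subspaceT => z; rewrite inE /= in_itv /= => hz.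
    apply/differentiable_continuous/derivable1_diffP.
    by have [] := h' z hz.
  have hd x : x \in `]u, v[%R -> is_derive x 1 f (df x).
    by rewrite in_itv /= => /andP[x1 x2]; apply: h'; rewrite !ltW.
  by have [c] := MVT_segment uv hd hc; rewrite in_itv /= => hc' ->; exists c.
have [ab|ba] := leP a b.
  by move: h; rewrite (min_idPl ab) (max_idPr ab); exact: key.
move: h; rewrite (min_idPr (ltW ba)) (max_idPl (ltW ba)) => h.
have [c hc e] := key _ _ (ltW ba) h; exists c => //.
by rewrite -[LHS]opprB e -mulrN opprB.
Qed.

Section Differentiability.
Context {R : realType} {d : nat}.
Implicit Types (f : 'rV[R]_d -> R) (U : set 'rV[R]_d).

Lemma is_derive_line (V W : normedModType R) (f : V -> W) (p v : V) (s : R) D :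
  is_derive (s *: v + p) v f D -> is_derive s 1 (fun t : R => f (t *: v + p)) D.
Proof.
case=> H1 H2.
have E : (fun h : R => h^-1 *: (((fun t : R => f (t *: v + p)) \o shift s) (h *: 1)
    - f (s *: v + p))) =
   (fun h : R => h^-1 *: ((f \o shift (s *: v + p)) (h *: v) - f (s *: v + p))).
  apply/funext => h /=; congr (_ *: (f _ - _)).
  by rewrite [h *: 1]mulr1 scalerDl addrA.
by split; [rewrite /derivable E|rewrite -H2 /derive E].
Qed.

(* The increment is decomposed along the coordinate directions, changing one
   coordinate of [z] into that of [z'] at a time. *)
Lemma box_increment f (c a : 'rV[R]_d) (r e : R) (z z' : 'rV[R]_d) :
  (forall y : 'rV[R]_d, (forall i, `|y 0 i - c 0 i| <= r) -> forall i,
     derivable f y (basis_vec i) /\ `|'D_(basis_vec i) f y - a 0 i| <= e) ->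
  (forall i, `|z 0 i - c 0 i| <= r) -> (forall i, `|z' 0 i - c 0 i| <= r) ->
  `|f z' - f z - \sum_i (z' 0 i - z 0 i) * a 0 i| <=
    e * \sum_i `|z' 0 i - z 0 i|.
Proof.
move=> h hz hz'.
pose p (k : nat) : 'rV[R]_d := \row_j (if (j < k)%N then z' 0 j else z 0 j).
have p0 : p 0%N = z by apply/rowP => j; rewrite mxE.
have pd : p d = z' by apply/rowP => j; rewrite mxE ltn_ord.
have step (k : 'I_d) : `|f (p k.+1) - f (p k) - (z' 0 k - z 0 k) * a 0 k| <=
    e * `|z' 0 k - z 0 k|.
  set D := z' 0 k - z 0 k.
  have pS : p k.+1 = D *: basis_vec k + p k.
    apply/rowP => j; rewrite !mxE /= ltnS leq_eqVlt.
    have [->|jk] /= := eqVneq j k.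
      by rewrite eqxx ltnn mulr1 subrK.
    by rewrite -[(j : nat) == k]/(j == k) (negbTE jk) mulr0 add0r.
  have pin s : Num.min 0 D <= s <= Num.max 0 D ->
      forall i, `|(s *: basis_vec k + p k) 0 i - c 0 i| <= r.
    move=> hs i; rewrite !mxE /=.
    have [->|ik] /= := eqVneq i k; last first.
      by rewrite mulr0 add0r; case: ifP.
    rewrite ltnn mulr1; move: (hz k) (hz' k) hs; rewrite /D !ler_norml.
    by case: (leP 0 _) => ? /andP[? ?] /andP[? ?] /andP[? ?]; apply/andP; split; lra.
  have [s|s hs E] := @MVT_unordered R (fun s => f (s *: basis_vec k + p k))
    (fun s => 'D_(basis_vec k) f (s *: basis_vec k + p k)) 0 D.
    move=> /pin/h/(_ k)[df _]; apply: is_derive_line; exact: derivableP.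
  rewrite scale0r add0r subr0 -pS in E.
  rewrite E mulrC -mulrBr normrM mulrC ler_wpM2r //.
  by have [] := h _ (pin s hs) k.
have -> : f z' - f z = \sum_(k < d) (f (p k.+1) - f (p k)).
  by rewrite -(big_mkord xpredT (fun k => f (p k.+1) - f (p k))) telescope_sumr // pd p0.
rewrite -sumrB (le_trans (ler_norm_sum _ _ _)) // mulr_sumr.
by apply: ler_sum => k _; exact: step.
Qed.

(** With [a] the row of partial derivatives, this is the candidate for the differential. *)
Definition dotl (a v : 'rV[R]_d) : R := \sum_i v 0 i * a 0 i.

Lemma dotl_is_linear a : linear (dotl a).
Proof.
move=> k u v; rewrite /dotl /GRing.scale /= mulr_sumr -big_split /=.
by apply: eq_bigr => i _; rewrite !mxE mulrDl mulrA.
Qed.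

HB.instance Definition _ a :=
  GRing.isLinear.Build R 'rV[R]_d R *%R (dotl a) (dotl_is_linear a).

Lemma norm_coord (v : 'rV[R]_d) i : `|v 0 i| <= `|v|.
Proof.
rewrite [leRHS]/Num.Def.normr /= mx_normrE.
exact: (le_bigmax _ (fun ij : 'I_1 * 'I_d => `|v ij.1 ij.2|) (0, i)).
Qed.

Lemma sum_norm_coord (v : 'rV[R]_d) : \sum_i `|v 0 i| <= d%:R * `|v|.
Proof.
apply: le_trans (ler_sum _ (fun i _ => norm_coord v i)) _.
by rewrite sumr_const card_ord mulr_natl.
Qed.

Lemma dotl_continuous a : continuous (dotl a).
Proof.
move=> v; rewrite /dotl; elim: (index_enum _) => [|i r IH].
  have -> : (fun v : 'rV[R]_d => \sum_(i <- [::]) v 0 i * a 0 i) = cst 0.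
    by apply/funext => u; rewrite big_nil.
  exact: cst_continuous.
have -> : (fun v : 'rV[R]_d => \sum_(j <- i :: r) v 0 j * a 0 j) =
    (fun v : 'rV[R]_d => v 0 i * a 0 i) + (fun v : 'rV[R]_d => \sum_(j <- r) v 0 j * a 0 j).
  by apply/funext => u; rewrite big_cons.
apply: (@continuousD R) => //.
by apply: continuousM; [exact: coord_continuous|exact: cst_continuous].
Qed.

Lemma norm_lt_coord (v : 'rV[R]_d) (r : R) : 0 < r ->
  (forall i, `|v 0 i| < r) -> `|v| < r.
Proof.
move=> r0 h; rewrite [ltLHS]/Num.Def.normr /= mx_normrE.
apply: bigmax_lt => // -[i j] _ /=.
by rewrite (ord1 i).
Qed.

(** On a small box around [y] the partial derivatives are close to those at [y], so [box_increment]
    makes the remainder [o(|v|)]. *)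
Lemma Ck1_differentiable (U : set 'rV[R]_d) f y : open U -> Ck 1 U f -> U y ->
  differentiable f y /\
  forall v, 'D_v f y = \sum_i v 0 i * 'D_(basis_vec i) f y.
Proof.
move=> oU Cf Uy.
pose a : 'rV[R]_d := \row_i 'D_(basis_vec i) f y.
have o : f \o shift y = cst (f y) + dotl a +o_ (0 : 'rV[R]_d) id.
  apply/eqaddoP => e e0.
  (* The coordinates of [v] add up to at most [d * |v|] in absolute value; [d + 1] avoids a zero
     denominator for [d = 0]. *)
  have e1 : 0 < e / (d%:R + 1) by rewrite divr_gt0 // ltr_wpDl.
  have nr : \forall z \near y, forall i, derivable f z (basis_vec i) /\
      `|'D_(basis_vec i) f z - a 0 i| <= e / (d%:R + 1).
    suff hi i : \forall z \near y, derivable f z (basis_vec i) /\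
      `|'D_(basis_vec i) f z - a 0 i| <= e / (d%:R + 1).
      exact: (@filter_forall _ _ _ _ (nbhs_filter y) hi).
    have [df [cdf _]] := Cf.2 i.
    have := cdf _ Uy => /cvgrPdist_le /(_ _ e1) hc.
    have oU' : \forall z \near y, U z by apply: (near_open oU Uy).
    near=> z; split; first by apply: df; near: z.
    by rewrite mxE distrC; near: z.
  have /nbhs_ballP[r /= r0 hr] := nr.
  have hr0 : \forall v \near (0 : 'rV[R]_d), `|v| <= r / 2.
    by apply: nbhs0_le; rewrite divr_gt0.
  near=> v.
  rewrite /= /cst /shift /=.
  have hv : `|v| <= r / 2 by near: v; exact: hr0.
  have hb (z : 'rV[R]_d) : (forall i, `|z 0 i - y 0 i| <= r / 2) -> ball y r z.
    move=> hz; rewrite -ball_normE /=; apply: norm_lt_coord => // i.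
    rewrite !mxE distrC (le_lt_trans (hz i)) // ltr_pdivrMr // ltr_pMr //.
    by rewrite ltr1n.
  have nv i : `|(v + y) 0 i - y 0 i| <= `|v|.
    by rewrite mxE addrK norm_coord.
  have h := @box_increment f y a (r / 2) (e / (d%:R + 1)) y (v + y)
    (fun z hz => hr z (hb z hz)).
  have {h} : `|f (v + y) - f y - dotl a v| <= e / (d%:R + 1) * \sum_i `|v 0 i|.
    have E (F : R -> R -> R) : \sum_i F ((v + y) 0 i - y 0 i) (a 0 i) =
        \sum_i F (v 0 i) (a 0 i).
      by apply: eq_bigr => i _; rewrite mxE addrK.
    move: h; rewrite (E (fun s t => s * t)) (E (fun s _ => `|s|)); apply.
      by move=> i; rewrite subrr normr0 divr_ge0 // ltW.
    by move=> i; exact: le_trans (nv i) hv.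
  move=> h; rewrite -[X in `|X|]/(f (v + y) - (f y + dotl a v)) opprD addrA.
  apply: le_trans h _; rewrite mulrAC -mulrA; apply: ler_wpM2l; first exact: ltW.
  rewrite ler_pdivrMr ?ltr_wpDl // mulrC.
  apply: le_trans (sum_norm_coord v) _.
  by rewrite ler_wpM2r // lerDl.
have dE := diff_unique (@dotl_continuous a) o.
have df : differentiable f y.
  by apply/diff_locallyP; rewrite dE; split => //; exact: dotl_continuous.
split=> // v; rewrite deriveE // dE /dotl.
by apply: eq_bigr => i _; rewrite mxE.
Unshelve. all: by end_near. Qed.

Lemma is_derive_comp (V W : normedModType R) (X : normedModType R) (f : V -> W)
    (t : X -> V) y v w :
  differentiable f (t y) -> differentiable t y -> 'D_v t y = w ->
  is_derive y v (f \o t) ('D_w f (t y)).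
Proof.
move=> df dt <-; have dft : differentiable (f \o t) y by exact: differentiable_comp.
split; first exact: diff_derivable.
by rewrite !deriveE // diff_comp.
Qed.

Lemma Ck_coord n m (U : set 'rV[R]_d) (f : 'rV[R]_d -> 'rV[R]_m) (j : 'I_m) :
  open U -> Ck n U f -> Ck n U (fun y => f y 0 j : R).
Proof.
move=> oU; elim: n f => [|n IH] f Cf.
  split=> // y Uy; apply: (@continuous_comp _ _ _ f (fun v : 'rV[R]_m => v 0 j)).
    exact: Cf.1.
  exact: coord_continuous.
split=> [y Uy|i].
  apply: (@continuous_comp _ _ _ f (fun v : 'rV[R]_m => v 0 j)); first exact: Cf.1.
  exact: coord_continuous.
have [df Cdf] := Cf.2 i; split=> [y /df/derivable_mxP//|].
apply: (@eq_Ck R d R n U (fun y => ('D_(basis_vec i) f y) 0 j)) => //.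
  by move=> y /df dfy; rewrite derive_mx // mxE.
exact: IH.
Qed.

Lemma smooth_on_coord m (U : set 'rV[R]_d) (f : 'rV[R]_d -> 'rV[R]_m) (j : 'I_m) :
  open U -> smooth_on U f -> smooth_on U (fun y => f y 0 j : R).
Proof. by move=> oU /smooth_onP Cf; apply/smooth_onP => n; exact: Ck_coord. Qed.

Lemma smooth_on_differentiable (U : set 'rV[R]_d) f y :
  open U -> smooth_on U f -> U y -> differentiable f y.
Proof.
by move=> oU /smooth_onP Cf Uy; have [] := Ck1_differentiable oU (Cf 1%N) Uy.
Qed.

Lemma smooth_on_differentiable_row m (U : set 'rV[R]_d) (f : 'rV[R]_d -> 'rV[R]_m) y :
  open U -> smooth_on U f -> U y -> differentiable f y.
Proof.
move=> oU sf Uy.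
have -> : f = \sum_i (fun y => f y 0 i *: delta_mx 0 i).
  by apply/funext => z; rewrite fct_sumE [LHS]row_sum_delta.
apply: differentiable_sum => i; apply: differentiableZl.
exact: (smooth_on_differentiable oU (smooth_on_coord i oU sf) Uy).
Qed.

Definition box (c : 'rV[R]_d) (r : R) : set 'rV[R]_d :=
  [set y | forall i, `|y 0 i - c 0 i| <= r].

Lemma compact_box c r : compact (box c r).
Proof.
have -> : box c r = [set v : 'rV[R]_d | forall i, [set x | `|x - c 0 i| <= r] (v ord0 i)].
  by [].
apply: (@rV_compact _ _ (fun i => [set x | `|x - c 0 i| <= r])) => i.
have -> : [set x | `|x - c 0 i| <= r] = `[c 0 i - r, c 0 i + r]%classic.
  by apply/seteqP; split=> x /=; rewrite in_itv /= ler_distl.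
exact: segment_compact.
Qed.

Lemma bounded_on_box (U : set 'rV[R]_d) f c r : (forall y, U y -> {for y, continuous f}) ->
  box c r `<=` U -> exists2 C, 0 <= C & forall y, box c r y -> `|f y| <= C.
Proof.
move=> cf bU.
have /compact_bounded/ex_strict_bound_gt0[C C0 hC] : compact (f @` box c r).
  apply: continuous_compact; last exact: compact_box.
  by apply: continuous_in_subspaceT => y; rewrite inE => /bU/cf.
by exists C; [exact: ltW|move=> y hy; apply/ltW/hC; exists y].
Qed.

Lemma lipschitz_on_box (U : set 'rV[R]_d) f c r : open U -> smooth_on U f ->
  box c r `<=` U -> exists2 C, 0 <= C & forall z z', box c r z -> box c r z' ->
    `|f z' - f z| <= C * \sum_i `|z' 0 i - z 0 i|.
Proof.
move=> oU sf bU.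
have h i : exists C, 0 <= C /\
    forall y, box c r y -> `|'D_(basis_vec i) f y| <= C.
  have [y Uy|C C0 hC] := @bounded_on_box U ('D_(basis_vec i) f) c r _ bU; last by exists C.
  exact: smooth_on_cont (smooth_on_derive i sf) Uy.
have [C hC] := choice h.
exists (\sum_i C i); first by apply: sumr_ge0 => i _; have [] := hC i.
move=> z z' hz hz'.
(* With [a = 0] the estimate bounds the increment of [f] itself. *)
have := @box_increment f c 0 r (\sum_i C i) z z' _ hz hz'.
rewrite [X in _ - X]big1 ?subr0 => [|i _]; last by rewrite mxE mulr0.
apply=> y hy i; split; first exact: smooth_on_derivable sf (bU _ hy).
rewrite mxE subr0; have [_ /(_ _ hy) h1] := hC i; apply: le_trans h1 _.
rewrite (bigD1 i) //= lerDl sumr_ge0 // => j _.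
by have [] := hC j.
Qed.

End Differentiability.

(** * Gronwall's inequality for the distance rho *)

Section Gronwall.
Context {R : realType}.

Lemma is_derive_sumT (J : Type) (r : seq J) (F dF : J -> R -> R) (t : R) :
  (forall j, is_derive t 1 (F j) (dF j t)) ->
  is_derive t 1 (fun s => \sum_(j <- r) F j s) (\sum_(j <- r) dF j t).
Proof.
move=> h; elim: r => [|j r IH].
  rewrite big_nil; have -> : (fun s => \sum_(j <- [::]) F j s) = cst 0.
    by apply/funext => s; rewrite big_nil.
  exact: is_derive_cst.
rewrite big_cons; have -> : (fun s => \sum_(i <- j :: r) F i s) =
    F j + (fun s => \sum_(i <- r) F i s).
  by apply/funext => s; rewrite big_cons.
exact: is_deriveD.
Qed.

(** For [t >= 0] the function [exp (- K t) * q t] does not increase; negative times follow by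
    reversing time. *)
Lemma gronwall (q dq : R -> R) (K : R) :
  (forall t : R, is_derive t 1 q (dq t)) -> (forall t, `|dq t| <= K * q t) ->
  forall t, q t <= expR (K * `|t|) * q 0.
Proof.
have key (u du : R -> R) : (forall t : R, is_derive t 1 u (du t)) ->
    (forall t, du t <= K * u t) -> forall t, 0 <= t -> u t <= expR (K * t) * u 0.
  move=> du1 du2 t t0.
  pose h := (fun s : R => expR (- (K * s)) * u s).
  have dh (s : R) : is_derive s 1 h (expR (- (K * s)) * (du s - K * u s)).
    have d1 : is_derive s 1 (fun s : R => - (K * s)) (- K).
      have := @is_deriveN _ _ _ (fun s : R => K * s) s 1 K.
      apply; have := @is_deriveM _ _ (cst K) id s 1 0 1 (is_derive_cst _ _ _) (is_derive_id _ _).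
      by move=> H; apply: (is_derive_eq H); rewrite /GRing.scale /= mulr0 addr0 mulr1.
    have d2 := @is_derive1_comp R expR (fun s : R => - (K * s)) s _ _ (is_derive_expR _) d1.
    have := @is_deriveM _ _ _ _ s 1 _ _ d2 (du1 s).
    by move=> H; apply: (is_derive_eq H); rewrite /GRing.scale /=; ring.
  have [c _ E] := @MVT_unordered R h _ 0 t (fun s _ => dh s).
  have : h t <= h 0.
    rewrite -subr_le0 E subr0 mulr_le0_ge0 // mulr_ge0_le0 ?expR_ge0 //.
    by rewrite subr_le0.
  rewrite /h mulr0 oppr0 expR0 mul1r expRN -ler_pdivlMl ?invr_gt0 ?expR_gt0 //.
  by rewrite invrK mulrC.
move=> dq1 dq2 t; have [t0|t0] := leP 0 t.
  by rewrite ger0_norm //; apply: key t0 => // s; apply: le_trans (dq2 s); exact: ler_norm.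
rewrite ltr0_norm //.
have := key (fun s => q (- s)) (fun s => - dq (- s)) _ _ (- t).
rewrite opprK oppr0; apply.
- move=> s; have dN : is_derive s 1 (fun s : R => - s) (-1) by exact: is_deriveN.
  by have := @is_derive1_comp R q (fun s => - s) s _ (-1) (dq1 (- s)) dN; rewrite mulrN1.
- by move=> s; apply: le_trans (dq2 _); rewrite -normrN ler_norm.
- by rewrite oppr_ge0 ltW.
Qed.

(** Cauchy-Schwarz against a constant vector, from [2 a b <= a^2 + b^2]. *)
Lemma sqr_sum_norm (I : finType) (a : I -> R) :
  (\sum_i `|a i|) ^+ 2 <= #|I|%:R * \sum_i a i ^+ 2.
Proof.
rewrite expr2 big_distrlr /=.
have h : \sum_(i : I) \sum_(j : I) `|a i| * `|a j| <=
    \sum_(i : I) \sum_(j : I) (a i ^+ 2 / 2 + a j ^+ 2 / 2).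
  apply: ler_sum => i _; apply: ler_sum => j _.
  rewrite -(real_normK (num_real (a i))) -(real_normK (num_real (a j))).
  by have := sqr_ge0 (`|a i| - `|a j|); rewrite !expr2; nra.
apply: le_trans h _.
have -> : \sum_(i : I) \sum_(j : I) (a i ^+ 2 / 2 + a j ^+ 2 / 2) =
    \sum_(i : I) \sum_(j : I) a i ^+ 2 / 2 + \sum_(i : I) \sum_(j : I) a j ^+ 2 / 2.
  by rewrite -big_split /=; apply: eq_bigr => i _; rewrite big_split.
rewrite exchange_big /= sumr_const -mulr_suml -mulrnDl -splitr.
by rewrite mulr_natl.
Qed.

End Gronwall.

Section FlowDistance.
Context {R : realType} {M : Type} {I : finType}.
Context (g : R -> M -> M) (f f' : I -> M -> R) (L : R).

(** Two comparable sizes of the same difference: [rho] obeys the triangle inequality and carries the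
    Lipschitz bounds, while [qdist] is differentiable along curves. *)
Definition rho (x y : M) : R := \sum_k `|f k x - f k y|.
Definition qdist (x y : M) : R := \sum_k (f k x - f k y) ^+ 2.

Lemma rho_ge0 x y : 0 <= rho x y. Proof. exact: sumr_ge0. Qed.

Lemma rhoC x y : rho x y = rho y x.
Proof. by apply: eq_bigr => k _; rewrite distrC. Qed.

Lemma rhoxx x : rho x x = 0.
Proof. by apply: big1 => k _; rewrite subrr normr0. Qed.

Lemma rho_triangle y x z : rho x z <= rho x y + rho y z.
Proof. by rewrite -big_split; apply: ler_sum => k _; exact: ler_distD. Qed.

Lemma le_rho k x y : `|f k x - f k y| <= rho x y.
Proof. by rewrite /rho (bigD1 k) //= lerDl; exact: sumr_ge0. Qed.

Lemma sqr_rho x y : rho x y ^+ 2 <= #|I|%:R * qdist x y.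
Proof. exact: (sqr_sum_norm (fun k => f k x - f k y)). Qed.

Lemma qdist_le x y : qdist x y <= rho x y ^+ 2.
Proof.
rewrite expr2 {1}/rho mulr_suml; apply: ler_sum => k _.
by rewrite -(real_normK (num_real (_ - _))) expr2 ler_wpM2l // le_rho.
Qed.

Lemma qdist_ge0 x y : 0 <= qdist x y.
Proof. by apply: sumr_ge0 => k _; exact: sqr_ge0. Qed.

(** Stated for arbitrary families of real curves because it serves twice: for two trajectories, and
    for a trajectory against a time shift of another one. *)
Lemma curve_gronwall (u v u' v' : I -> R -> R) :
  0 <= L ->
  (forall k (t : R), is_derive t 1 (u k) (u' k t)) ->
  (forall k (t : R), is_derive t 1 (v k) (v' k t)) ->
  (forall k t, `|u' k t - v' k t| <= L * \sum_j `|u j t - v j t|) ->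
  forall t, \sum_k (u k t - v k t) ^+ 2 <=
    expR (2 * L * #|I|%:R * `|t|) * \sum_k (u k 0 - v k 0) ^+ 2.
Proof.
move=> L0 du dv h.
apply: (@gronwall R (fun t => \sum_k (u k t - v k t) ^+ 2)
  (fun t => \sum_k 2 * (u k t - v k t) * (u' k t - v' k t))) => t.
  apply: (@is_derive_sumT R I _ (fun k s => (u k s - v k s) ^+ 2)
    (fun k t => 2 * (u k t - v k t) * (u' k t - v' k t))) => k.
  have d1 := @is_deriveB _ _ _ _ _ t 1 _ _ (du k t) (dv k t).
  have := @is_deriveM _ _ _ _ t 1 _ _ d1 d1.
  have -> : (u k - v k) * (u k - v k) = (fun s => (u k s - v k s) ^+ 2).
    by apply/funext => s; rewrite expr2.
  move=> H; apply: (is_derive_eq H); rewrite /GRing.scale /= !fctE; ring.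
apply: le_trans (ler_norm_sum _ _ _) _.
have -> : 2 * L * #|I|%:R * (\sum_k (u k t - v k t) ^+ 2) =
  2 * L * (#|I|%:R * (\sum_k (u k t - v k t) ^+ 2)) by ring.
apply: (@le_trans _ _ (2 * L * (\sum_k `|u k t - v k t|) ^+ 2)); last first.
  by apply: ler_wpM2l (sqr_sum_norm _); rewrite mulr_ge0.
set S := \sum_k `|u k t - v k t|.
have -> : 2 * L * S ^+ 2 = \sum_k 2 * `|u k t - v k t| * (L * S).
  by rewrite -mulr_suml -mulr_sumr -/S expr2; ring.
apply: ler_sum => k _; rewrite !normrM ger0_norm //.
by apply: ler_wpM2l; rewrite ?mulr_ge0.
Qed.

Context (L0 : 0 <= L)
  (der : forall k x (t : R), is_derive t 1 (fun s => f k (g s x)) (f' k (g t x)))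
  (lip : forall k x y, `|f' k x - f' k y| <= L * rho x y).

Lemma qdist_flow t x y :
  qdist (g t x) (g t y) <= expR (2 * L * #|I|%:R * `|t|) * qdist (g 0 x) (g 0 y).
Proof.
exact: (@curve_gronwall (fun k t => f k (g t x)) (fun k t => f k (g t y))
  (fun k t => f' k (g t x)) (fun k t => f' k (g t y))).
Qed.

Context (g0 : forall x, g 0 x = x).

(** Gronwall bounds the square of [rho]; [#|I| + 1] majorizes the square root of the factor [#|I|]
    lost in passing from [qdist] to [rho]. *)
Definition flow_lip (T : R) : R := (#|I|%:R + 1) * expR (L * #|I|%:R * T).

Lemma flow_lip_ge0 T : 0 <= flow_lip T.
Proof. by rewrite mulr_ge0 ?expR_ge0. Qed.

Lemma rho_flow T t x y : `|t| <= T -> rho (g t x) (g t y) <= flow_lip T * rho x y.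
Proof.
move=> tT; rewrite -(@ler_pXn2r _ 2) ?nnegrE ?mulr_ge0 ?rho_ge0 ?flow_lip_ge0 //.
apply: le_trans (sqr_rho _ _) _.
have N0 : 0 <= #|I|%:R :> R by [].
apply: le_trans (ler_wpM2l N0 (qdist_flow t x y)) _.
rewrite !g0 exprMn /flow_lip exprMn -expRM_natl -[leRHS]mulrA.
have hN : #|I|%:R <= (#|I|%:R + 1) ^+ 2 :> R by rewrite expr2; nra.
apply: ler_pM => //; first by rewrite mulr_ge0 ?expR_ge0 ?qdist_ge0.
apply: ler_pM (qdist_le _ _); rewrite ?expR_ge0 ?qdist_ge0 //.
rewrite ler_expR -!mulrA; apply: ler_wpM2l => //.
by rewrite !mulrA; apply: ler_wpM2l => //; rewrite mulr_ge0.
Qed.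

(* Only the functions [f k] are compared, so that no uniqueness of trajectories
   in [M] is needed. *)
Lemma flow_group k t s x : f k (g t (g s x)) = f k (g (t + s) x).
Proof.
have dsh j (t' : R) : is_derive t' 1 (fun t => f j (g (t + s) x)) (f' j (g (t' + s) x)).
  have dS : is_derive t' 1 (fun t : R => t + s) 1.
    have := @is_deriveD _ _ _ _ _ t' 1 _ _ (is_derive_id t' 1) (is_derive_cst s t' 1).
    by move=> H; apply: (is_derive_eq H); rewrite addr0.
  have := @is_derive1_comp R (fun t => f j (g t x)) (fun t => t + s) t' _ _ (der j x _) dS.
  by rewrite mulr1.
have := @curve_gronwall (fun k t => f k (g t (g s x))) (fun k t => f k (g (t + s) x))
  (fun k t => f' k (g t (g s x))) (fun k t => f' k (g (t + s) x)) L0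
  (fun k t => der k (g s x) t) dsh (fun k t' => lip k _ _) t.
rewrite [X in _ * X]big1 => [|j _]; last by rewrite g0 add0r subrr expr0n.
rewrite mulr0 => h; apply/eqP; rewrite -subr_eq0 -sqrf_eq0 eq_le sqr_ge0 andbT.
by apply: le_trans h; rewrite (bigD1 k) //= lerDl sumr_ge0 // => j _; exact: sqr_ge0.
Qed.

Lemma rho_group t s x z : rho (g t (g s x)) z = rho (g (t + s) x) z.
Proof. by apply: eq_bigr => k _; rewrite flow_group. Qed.

End FlowDistance.

(** * The value function and its regularization *)

Section Value.
Context {R : realType} {M : Type} {I : finType}.
Context (g : R -> M -> M) (f f' : I -> M -> R) (L : R) (X1 : set M) (T C : R).
Context (L0 : 0 <= L) (T0 : 0 < T) (C0 : 0 <= C)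
  (der : forall k x (t : R), is_derive t 1 (fun s => f k (g s x)) (f' k (g t x)))
  (lip : forall k x y, `|f' k x - f' k y| <= L * rho f x y)
  (g0 : forall x, g 0 x = x).

(* The cost of reaching [X1] from [x]: a time [t], and a penalty for missing. *)
Definition costs (x : M) : set R :=
  [set v | v = 1 \/ exists t z, X1 z /\ v = `|t| / T + C * rho f (g t x) z].
(** The cost 1 truncates the value and keeps [costs] nonempty when [X1] is empty, where the real
    [inf] would be a default value. *)
Definition value (x : M) : R := inf (costs x).

Lemma costs_ge0 x v : costs x v -> 0 <= v.
Proof.
case=> [->//|[t [z [_ ->]]]].
by rewrite addr_ge0 ?mulr_ge0 ?rho_ge0 // invr_ge0 ltW.
Qed.

Lemma costs_neq0 x : costs x !=set0. Proof. by exists 1; left. Qed.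

Lemma value_lb x : has_lbound (costs x).
Proof. by exists 0 => v /costs_ge0. Qed.

Lemma value_le x v : costs x v -> value x <= v.
Proof. by apply: ge_inf; exact: value_lb. Qed.

Lemma le_value x e : (forall v, costs x v -> e <= v) -> e <= value x.
Proof. by move=> h; apply: lb_le_inf => //; exact: costs_neq0. Qed.

Lemma value_le1 x : value x <= 1.
Proof. by apply: value_le; left. Qed.

Lemma value_target x : X1 x -> value x <= 0.
Proof.
move=> hx; apply: value_le; right; exists 0, x; split=> //.
by rewrite normr0 mul0r add0r g0 rhoxx mulr0.
Qed.

(** Times beyond [T] already cost more than 1, so the penalty only has to act for [|t| <= T]. *)
Lemma value_far x :
  (forall t z, `|t| <= T -> X1 z -> 1 <= C * rho f (g t x) z) -> 1 <= value x.
Proof.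
move=> h; apply: le_value => v [->//|[t [z [hz ->]]]].
have [tT|tT] := leP `|t| T.
  apply: le_trans (h t z tT hz) _.
  by rewrite lerDr divr_ge0 // ltW.
apply: (@le_trans _ _ (`|t| / T)); first by rewrite ler_pdivlMr // mul1r ltW.
by rewrite lerDl mulr_ge0 // rho_ge0.
Qed.

(** Dynamic programming: time [t] from [x] is time [t - s] from [g s x], with the same end point as
    far as [rho] can see. *)
Lemma value_flow s x : value (g s x) <= value x + `|s| / T.
Proof.
rewrite -lerBlDr; apply: le_value => v hv; rewrite lerBlDr.
case: hv => [->|[t [z [hz ->]]]].
  by apply: le_trans (value_le1 _) _; rewrite lerDl divr_ge0 // ltW.
apply: (@le_trans _ _ (`|t - s| / T + C * rho f (g t x) z)).
  apply: value_le; right; exists (t - s), z; split=> //.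
  by rewrite (rho_group L0 der lip g0) subrK.
rewrite addrAC lerD2r -mulrDl ler_wpM2r ?invr_ge0 ?(ltW T0) //.
exact: ler_normB.
Qed.

(** Gronwall's factor grows with time, but times beyond [T] do no better than the cost 1, so
    [flow_lip] at [T] serves uniformly. *)
Lemma value_lip x y : value x <= value y + C * flow_lip L T (I := I) * rho f x y.
Proof.
have A0 : 0 <= C * flow_lip L T (I := I) * rho f x y.
  by rewrite !mulr_ge0 ?rho_ge0 ?flow_lip_ge0.
rewrite -lerBlDr; apply: le_value => v hv; rewrite lerBlDr.
case: hv => [->|[t [z [hz ->]]]].
  by apply: le_trans (value_le1 _) _; rewrite lerDl.
have [tT|tT] := leP `|t| T; last first.
  apply: le_trans (value_le1 _) _; rewrite -addrA.
  apply: (@le_trans _ _ (`|t| / T)); first by rewrite ler_pdivlMr // mul1r ltW.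
  by rewrite lerDl addr_ge0 // mulr_ge0 // rho_ge0.
apply: (@le_trans _ _ (`|t| / T + C * rho f (g t x) z)).
  by apply: value_le; right; exists t, z.
rewrite -addrA lerD2l -mulrA -mulrDr ler_wpM2l //.
apply: le_trans (rho_triangle f (g t y) _ _) _.
by rewrite addrC lerD2l; exact: (rho_flow L0 der lip g0).
Qed.

End Value.

(** * The soft minimum of quadratic costs *)

Section Softmin.
Context {R : realType} {M : Type} {I : finType}.
Context (f f' : I -> M -> R).

Definition cost {J : finType} (eps : R) (a : J -> R) (y : J -> M) (j : J) (x : M) : R :=
  a j + qdist f (y j) x / (2 * eps).

Definition softmin {J : finType} (lam eps : R) (a : J -> R) (y : J -> M) (x : M) : R :=
  - (lam^-1 * ln (\sum_j expR (- lam * cost eps a y j x))).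

Context {J : finType} (j0 : J) (lam eps : R) (a : J -> R) (y : J -> M)
  (lam0 : 0 < lam) (eps0 : 0 < eps).
Local Notation E := (cost eps a y).
Local Notation h := (softmin lam eps a y).
Local Notation S x := (\sum_j expR (- lam * E j x)).

Lemma softmin_sum_gt0 x : 0 < S x.
Proof.
by rewrite (bigD1 j0) //= ltr_pwDl ?expR_gt0 // sumr_ge0 // => j _; exact: expR_ge0.
Qed.

Lemma softmin_sumE x : S x = expR (- lam * h x).
Proof.
by rewrite /softmin mulNr mulrN opprK mulVKf ?gt_eqF // lnK // posrE softmin_sum_gt0.
Qed.

Lemma softmin_le j x : h x <= E j x.
Proof.
rewrite -(ler_pM2l lam0) -lerN2 -!mulNr -ler_expR -softmin_sumE.
by rewrite (bigD1 j) //= lerDl sumr_ge0 // => k _; exact: expR_ge0.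
Qed.

(** The sum has [#|J|] terms, each at most [exp (- lam c)]. The condition on [#|J|] avoids a
    logarithm through [1 + u <= exp u]. *)
Lemma le_softmin c delta x : (forall j, c <= E j x) ->
  #|J|%:R <= 1 + lam * delta -> c - delta <= h x.
Proof.
move=> hc hJ.
have : S x <= expR (lam * delta - lam * c).
  rewrite expRD; apply: (@le_trans _ _ (#|J|%:R * expR (- (lam * c)))).
    rewrite mulr_natl -sumr_const; apply: ler_sum => j _.
    by rewrite ler_expR mulNr lerN2 ler_pM2l.
  rewrite ler_wpM2r ?expR_ge0 //; apply: le_trans hJ _; exact: expR_ge1Dx.
rewrite softmin_sumE ler_expR mulNr -mulrBr -mulrN ler_pM2l //.
by rewrite lerNl opprB.
Qed.

Definition dcost (j : J) (x : M) : R :=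
  - (eps^-1 * \sum_k (f k (y j) - f k x) * f' k x).

Lemma is_derive_cost (c : R -> M) (t : R) j :
  (forall k, is_derive t 1 (fun s => f k (c s)) (f' k (c t))) ->
  is_derive t 1 (fun s => E j (c s)) (dcost j (c t)).
Proof.
move=> dc.
have dq : is_derive t 1 (fun s => qdist f (y j) (c s))
    (\sum_k (- 2 * (f k (y j) - f k (c t)) * f' k (c t))).
  apply: (@is_derive_sumT R I _ (fun k s => (f k (y j) - f k (c s)) ^+ 2)
    (fun k t => - 2 * (f k (y j) - f k (c t)) * f' k (c t))) => k.
  have d1 := @is_deriveB _ _ _ _ _ t 1 _ _ (is_derive_cst (f k (y j)) t 1) (dc k).
  have := @is_deriveM _ _ _ _ t 1 _ _ d1 d1.
  have -> : (cst (f k (y j)) - (fun s => f k (c s))) * (cst (f k (y j)) - (fun s => f k (c s))) =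
    (fun s => (f k (y j) - f k (c s)) ^+ 2).
    by apply/funext => s; rewrite expr2.
  move=> H; apply: (is_derive_eq H); rewrite /GRing.scale /= !fctE; ring.
have d2 := @is_deriveM _ _ _ _ t 1 _ _ dq (is_derive_cst (2 * eps)^-1 t 1).
have := @is_deriveD _ _ _ _ _ t 1 _ _ (is_derive_cst (a j) t 1) d2.
move=> H; apply: (is_derive_eq H); rewrite /GRing.scale /= /cst mulr0 !add0r.
rewrite /dcost; have -> : \sum_k -2 * (f k (y j) - f k (c t)) * f' k (c t) =
  -2 * \sum_k (f k (y j) - f k (c t)) * f' k (c t).
  by rewrite mulr_sumr; apply: eq_bigr => k _; rewrite mulrA.
by field; rewrite gt_eqF.
Qed.

(** An average of the [dcost j] with Gibbs weights; written relative to [h], the weights are already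
    normalized ([softmin_weight_sum]). *)
Lemma is_derive_softmin (c : R -> M) (t : R) :
  (forall k, is_derive t 1 (fun s => f k (c s)) (f' k (c t))) ->
  is_derive t 1 (fun s => h (c s))
    (\sum_j expR (- lam * (E j (c t) - h (c t))) * dcost j (c t)).
Proof.
move=> dc.
have dS : is_derive t 1 (fun s => S (c s))
    (\sum_j (expR (- lam * E j (c t)) * (- lam * dcost j (c t)))).
  apply: (@is_derive_sumT R J _ (fun j s => expR (- lam * E j (c s)))
    (fun j t => expR (- lam * E j (c t)) * (- lam * dcost j (c t)))) => j.
  have d1 := @is_deriveM _ _ _ _ t 1 _ _ (is_derive_cst (- lam) t 1) (is_derive_cost j dc).
  have d2 := @is_derive1_comp R expR (fun s => - lam * E j (c s)) t _ _ (is_derive_expR _) d1.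
  by apply: (is_derive_eq d2); rewrite /GRing.scale /= /cst mulr0 addr0.
have dl := @is_derive1_comp R (@ln R) (fun s => S (c s)) t _ _
  (is_derive1_ln (softmin_sum_gt0 (c t))) dS.
have d3 := @is_deriveM _ _ _ _ t 1 _ _ (is_derive_cst (- lam^-1) t 1) dl.
have -> : (fun s => h (c s)) = cst (- lam^-1) * (@ln R \o (fun s => S (c s))).
  by apply/funext => s; rewrite /softmin -mulNr.
apply: (is_derive_eq d3); rewrite /GRing.scale /= /cst mulr0 addr0.
rewrite softmin_sumE !mulr_sumr; apply: eq_bigr => j _.
have -> : - lam * (E j (c t) - h (c t)) = - lam * E j (c t) - - lam * h (c t) by ring.
rewrite expRB; field.
by rewrite gt_eqF ?expR_gt0 // gt_eqF.
Qed.

Lemma softmin_weight_sum x : \sum_j expR (- lam * (E j x - h x)) = 1.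
Proof.
under eq_bigr do rewrite mulrBr expRB.
by rewrite -mulr_suml softmin_sumE divff // gt_eqF // expR_gt0.
Qed.

End Softmin.

Lemma is_derive_affine {R : realType} (h : R -> R) (t k b D : R) :
  is_derive t 1 h D -> is_derive t 1 (fun s => k * (b - h s)) (- (k * D)).
Proof.
move=> dh; have d1 := @is_deriveB _ _ _ _ _ t 1 _ _ (is_derive_cst b t 1) dh.
have d2 := @is_deriveM _ _ _ _ t 1 _ _ (is_derive_cst k t 1) d1.
by apply: (is_derive_eq d2); rewrite /GRing.scale /= /cst mulr0 addr0 sub0r mulrN.
Qed.

(** Supplies the small parameters of the proof. Adding [b] to the denominator covers [c = 0] and
    gives [t <= 1]. *)
Lemma pos_small {R : realType} (c b : R) : 0 <= c -> 0 < b ->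
  exists t, [/\ 0 < t, t <= 1 & c * t <= b].
Proof.
move=> c0 b0; have cb : 0 < c + b by rewrite ltr_wpDl.
exists (b / (c + b)); split; first by rewrite divr_gt0.
  by rewrite ler_pdivrMr // mul1r lerDr.
rewrite mulrCA; apply: ler_piMr; first exact: ltW.
by rewrite ler_pdivrMr // mul1r lerDl ltW.
Qed.

Section Net.
Context {R : realType} {M : Type} {I : finType} (f : I -> M -> R) (B : R).

(** The image under [f] lies in a cube, which is cut into finitely many cells; one point is picked
    per nonempty cell. The net covers all of [M] even when [M] is not compact. *)
Lemma rho_net (x0 : M) (kappa : R) : (forall k x, `|f k x| <= B) -> 0 < kappa ->
  exists (J : finType) (j0 : J) (y : J -> M), forall x, exists j, rho f (y j) x <= kappa.
Proof.
move=> hB k0.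
have [eta [e0 _ he]] := @pos_small R #|I|%:R kappa (ler0n _ _) k0.
pose w k x := (f k x + B) / eta.
have w0 k x : 0 <= w k x.
  rewrite divr_ge0 ?(ltW e0) // -lerBlDr sub0r.
  by have := hB k x; rewrite ler_norml => /andP[].
pose m := Num.truncn (2 * B / eta).
have wm k x : (Num.truncn (w k x) <= m)%N.
  apply: le_truncn; rewrite ler_pM2r ?invr_gt0 // mulr2n mulrDl mul1r lerD2r.
  by have := hB k x; rewrite ler_norml => /andP[].
pose cell x : {ffun I -> 'I_m.+1} := [ffun k => inord (Num.truncn (w k x))].
(* Empty cells receive the dummy representative [x0]. *)
have /choice[r hr] c : exists y, forall x, cell x = c -> cell y = c.
  have [[x hx]|nx] := pselect (exists x, cell x = c); first by exists x.
  by exists x0 => x hx; case: nx; exists x.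
exists {ffun I -> 'I_m.+1}, (cell x0), r => x; exists (cell x).
move: (r _) (hr _ _ (erefl (cell x))) => y hy.
apply: le_trans he; rewrite /rho mulr_natl -sumr_const; apply: ler_sum => k _.
have := congr1 (fun c : {ffun I -> 'I_m.+1} => nat_of_ord (c k)) hy.
rewrite !ffunE !inordK ?ltnS // => hk.
have /andP[a1 a2] := truncn_itv (w0 k x); have /andP[b1 b2] := truncn_itv (w0 k y).
rewrite hk in b1 b2.
have : `|w k y - w k x| <= 1.
  by rewrite ler_norml; move: a1 a2 b1 b2; rewrite -natr1 => *; apply/andP; split; lra.
rewrite -mulrBl opprD addrACA subrr addr0 normrM normfV (gtr0_norm e0).
by rewrite ler_pdivrMr // mul1r.
Qed.
End Net.

(** * Regularization of a Lipschitz function along the flow *)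

Section Smoothing.
Context {R : realType} {M : Type} {I : finType}.
Context (g : R -> M -> M) (f f' : I -> M -> R) (B L : R).
Context (B0 : 0 <= B) (L0 : 0 <= L)
  (der : forall k x (t : R), is_derive t 1 (fun s => f k (g s x)) (f' k (g t x)))
  (lip : forall k x y, `|f' k x - f' k y| <= L * rho f x y)
  (g0 : forall x, g 0 x = x)
  (hB : forall k x, `|f k x| <= B) (hB' : forall k x, `|f' k x| <= B).
Local Notation N := (#|I|%:R : R).
Local Notation rho := (rho f).
Local Notation Q := (qdist f).

Lemma rho_time x s : rho (g s x) x <= N * B * `|s|.
Proof.
rewrite -mulrA mulr_natl -sumr_const; apply: ler_sum => k _.
have [c _ E] := @MVT_unordered R (fun s => f k (g s x)) (fun s => f' k (g s x)) 0 s
  (fun t _ => der k x t).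
by rewrite g0 subr0 in E; rewrite E normrM ler_wpM2r.
Qed.

Lemma norm_sub_le k x y : `|f k x - f k y| <= 2 * B.
Proof.
apply: le_trans (ler_normB _ _) _.
by rewrite mulr2n mulrDl mul1r lerD.
Qed.

(** A Lipschitz constant in time at 0 for the derivative of [qdist (g s y) x]: the difference of
    products costs [2 * (B + 2 * B * (N * L))] per unit of [rho], and trajectories have [rho]-speed
    at most [N * B]. *)
Definition taylor_const : R := 2 * (B + 2 * B * (N * L)) * (N * B).

Lemma taylor_const_ge0 : 0 <= taylor_const.
Proof. by rewrite !mulr_ge0 // addr_ge0 // !mulr_ge0. Qed.

(** A second-order remainder from first derivatives only: the mean value theorem gives the
    derivative at an intermediate time, which the Lipschitz bound on [f'] compares with that at
    0. *)
Lemma qdist_taylor x y s :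
  Q (g s y) x <= Q y x + 2 * s * (\sum_k (f k y - f k x) * f' k y) +
    taylor_const * s ^+ 2.
Proof.
pose dphi t := \sum_k 2 * (f k (g t y) - f k x) * f' k (g t y).
have dQ (t : R) : is_derive t 1 (fun s => Q (g s y) x) (dphi t).
  apply: (@is_derive_sumT R I _ (fun k s => (f k (g s y) - f k x) ^+ 2)
    (fun k t => 2 * (f k (g t y) - f k x) * f' k (g t y))) => k.
  have d1 := @is_deriveB _ _ _ _ _ t 1 _ _ (der k y t) (is_derive_cst (f k x) t 1).
  have := @is_deriveM _ _ _ _ t 1 _ _ d1 d1.
  have -> : ((fun s => f k (g s y)) - cst (f k x)) * ((fun s => f k (g s y)) - cst (f k x)) =
    (fun s => (f k (g s y) - f k x) ^+ 2).
    by apply/funext => u; rewrite expr2.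
  move=> H; apply: (is_derive_eq H); rewrite /GRing.scale /= !fctE; ring.
have [c hc E] := @MVT_unordered R _ dphi 0 s (fun t _ => dQ t).
rewrite g0 subr0 in E.
have cs : `|c| <= `|s|.
  move: hc; case: (leP 0 s) => s0 /andP[c1 c2].
    by rewrite !ger0_norm // (le_trans _ c2).
  by rewrite !ler0_norm ?(ltW s0) // lerN2.
have d0 : dphi 0 = 2 * \sum_k (f k y - f k x) * f' k y.
  by rewrite /dphi mulr_sumr; apply: eq_bigr => k _; rewrite g0 mulrA.
have dd : `|dphi c - dphi 0| <= taylor_const * `|s|.
  rewrite /dphi -sumrB.
  apply: (@le_trans _ _ (2 * (B + 2 * B * (N * L)) * rho (g c y) y)); last first.
    rewrite /taylor_const -[leRHS]mulrA; apply: ler_wpM2l.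
      by rewrite mulr_ge0 // addr_ge0 // !mulr_ge0.
    by apply: le_trans (rho_time y c) _; rewrite ler_wpM2l // mulr_ge0.
  apply: le_trans (ler_norm_sum _ _ _) _.
  have -> : 2 * (B + 2 * B * (N * L)) * rho (g c y) y =
    \sum_k (2 * (`|f k (g c y) - f k y| * B + 2 * B * (L * rho (g c y) y))).
    rewrite -mulr_sumr big_split /= -mulr_suml sumr_const -/(rho (g c y) y).
    by rewrite -(mulr_natl _ #|I|); ring.
  apply: ler_sum => k _; rewrite g0.
  have -> : 2 * (f k (g c y) - f k x) * f' k (g c y) - 2 * (f k y - f k x) * f' k y =
    2 * ((f k (g c y) - f k y) * f' k (g c y) + (f k y - f k x) * (f' k (g c y) - f' k y)).
    by ring.
  rewrite normrM ger0_norm // ler_wpM2l //.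
  apply: le_trans (ler_normD _ _) _; rewrite !normrM; apply: lerD.
    by rewrite ler_wpM2l.
  by apply: ler_pM; rewrite ?norm_sub_le.
have : Q (g s y) x = Q y x + dphi 0 * s + (dphi c - dphi 0) * s.
  by rewrite -[LHS](subrK (Q y x)) E; ring.
move=> ->; rewrite d0 mulrAC; apply: lerD => //.
apply: le_trans (ler_norm _) _; rewrite normrM -(real_normK (num_real s)) expr2 mulrA.
by rewrite -d0 ler_wpM2r.
Qed.


Context (V : M -> R) (r L1 : R) (r0 : 0 <= r) (L10 : 0 <= L1)
  (V_flow : forall s x, V (g s x) <= V x + r * `|s|)
  (V_lip : forall x y, V x <= V y + L1 * rho x y).

(** Young's inequality. With [4 * eps] it consumes half of the penalty [Q x y / (2 * eps)]; the
    other half will bound the distance from [x] to a near-minimizer. *)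
Lemma lip_qdist eps x y : 0 < eps ->
  L1 * rho x y <= Q x y / (4 * eps) + N * L1 ^+ 2 * eps.
Proof.
move=> e0; have h := sqr_rho f x y; have rg := rho_ge0 f x y.
(* Completing the square divides by [N]; for empty [I] the distance is 0. *)
have [N0|N0] := eqVneq N 0.
  have /eqP : rho x y ^+ 2 = 0.
    by apply/eqP; rewrite eq_le sqr_ge0 andbT; rewrite N0 mul0r in h.
  rewrite sqrf_eq0 => /eqP ->; rewrite mulr0 addr_ge0 //.
    by rewrite divr_ge0 ?qdist_ge0 // mulr_ge0 // ltW.
  by rewrite !mulr_ge0 ?sqr_ge0 // ltW.
have {}N0 : 0 < N by rewrite lt0r N0 ler0n.
apply: (@le_trans _ _ (rho x y ^+ 2 / N / (4 * eps) + N * L1 ^+ 2 * eps)); last first.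
  rewrite lerD2r ler_wpM2r ?invr_ge0 ?mulr_ge0 ?(ltW e0) //.
  by rewrite ler_pdivrMr // mulrC.
have -> : rho x y ^+ 2 / N / (4 * eps) + N * L1 ^+ 2 * eps = L1 * rho x y +
    (rho x y - 2 * N * eps * L1) ^+ 2 / (4 * N * eps).
  by field; rewrite !gt_eqF.
by rewrite lerDl divr_ge0 ?sqr_ge0 // !mulr_ge0 // ltW.
Qed.

(** * Values and slopes of the soft minimum over a net *)

Section Bounds.
Context {J : finType} (j0 : J) (lam eps kappa delta sigma : R) (y : J -> M).
Context (lam0 : 0 < lam) (eps0 : 0 < eps) (kappa0 : 0 < kappa) (sigma0 : 0 < sigma)
  (delta0 : 0 <= delta)
  (net : forall x, exists j, rho (y j) x <= kappa)
  (hk1 : L1 * kappa + 2 * B / eps * kappa <= delta)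
  (hk2 : L1 * kappa + kappa ^+ 2 / (2 * eps) <= delta).
Local Notation a := (V \o y).
Local Notation E := (cost f eps a y).
Local Notation h := (softmin f lam eps a y).
Local Notation dE := (dcost f f' eps y).

Lemma softmin_upper x : h x <= V x + delta.
Proof.
have [j hj] := net x; apply: le_trans (softmin_le f j0 eps a y lam0 j x) _.
rewrite /cost /=; apply: (@le_trans _ _ (V x + (L1 * kappa + kappa ^+ 2 / (2 * eps)))).
  rewrite addrA lerD //.
    by apply: le_trans (V_lip (y j) x) _; rewrite lerD2l ler_wpM2l.
  rewrite ler_wpM2r ?invr_ge0 ?mulr_ge0 ?(ltW eps0) //.
  apply: le_trans (qdist_le _ _ _) _.
  by rewrite ler_pXn2r ?nnegrE ?rho_ge0 // ltW.
by rewrite lerD2l.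
Qed.

Lemma softmin_lower (e : R) x : #|J|%:R <= 1 + lam * e ->
  V x - N * L1 ^+ 2 * eps - e <= h x.
Proof.
move=> hJ; apply: (le_softmin (f := f) j0 lam0) hJ => j; rewrite /cost /=.
rewrite lerBlDr; apply: le_trans (V_lip x (y j)) _; rewrite -addrA lerD2l.
rewrite rhoC; apply: le_trans (lip_qdist _ _ eps0) _; rewrite lerD2r.
rewrite ler_wpM2l ?qdist_ge0 // lef_pV2 ?posrE ?mulr_gt0 //.
by rewrite ler_wpM2r ?(ltW eps0) // ler_nat.
Qed.

(* Compare with the value at a net point close to [g s (y j)]. *)
Lemma near_slope j x s : E j x <= h x + delta ->
  - (s / eps) * (\sum_k (f k (y j) - f k x) * f' k (y j)) <=
  r * `|s| + taylor_const * s ^+ 2 / (2 * eps) + 2 * delta.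
Proof.
move=> hj; set P := \sum_k _.
have [i hi] := net (g s (y j)).
have h1 := softmin_le f j0 eps a y lam0 i x.
have h2 : V (y i) <= V (y j) + r * `|s| + L1 * kappa.
  apply: le_trans (V_lip (y i) (g s (y j))) _; apply: lerD; first exact: V_flow.
  by rewrite ler_wpM2l.
(* A difference of squares whose second factor is at most [4 * B]; divided by [2 * eps], it is the
   second term in [hk1]. *)
have h3 : Q (y i) x <= Q (g s (y j)) x + 4 * B * kappa.
  rewrite -lerBlDl /qdist -sumrB.
  apply: (@le_trans _ _ (\sum_k 4 * B * `|f k (y i) - f k (g s (y j))|)); last first.
    by rewrite -mulr_sumr ler_wpM2l // mulr_ge0.
  apply: ler_sum => k _.
  have -> : (f k (y i) - f k x) ^+ 2 - (f k (g s (y j)) - f k x) ^+ 2 =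
    (f k (y i) - f k (g s (y j))) * ((f k (y i) - f k x) + (f k (g s (y j)) - f k x)).
    by ring.
  apply: le_trans (ler_norm _) _; rewrite normrM mulrC ler_wpM2r //.
  apply: le_trans (ler_normD _ _) _.
  by have := norm_sub_le k (y i) x; have := norm_sub_le k (g s (y j)) x; lra.
have h4 := qdist_taylor x (y j) s; rewrite -/P in h4.
have h5 : Q (y i) x / (2 * eps) <= Q (y j) x / (2 * eps) + s / eps * P +
    taylor_const * s ^+ 2 / (2 * eps) + 2 * B / eps * kappa.
  have -> : Q (y j) x / (2 * eps) + s / eps * P + taylor_const * s ^+ 2 / (2 * eps) +
     2 * B / eps * kappa =
    (Q (y j) x + 2 * s * P + taylor_const * s ^+ 2 + 4 * B * kappa) / (2 * eps).
    by field; rewrite gt_eqF.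
  rewrite ler_pM2r ?invr_gt0 ?mulr_gt0 //; lra.
move: h1 hj; rewrite /cost /= mulNr; move: h2 h5 hk1; clear h3 h4; clearbody P.
move: (softmin _ _ _ _ _ _) (Q (y i) x / _) (Q (y j) x / _) (s / eps * P)
  (taylor_const * _ / _) (2 * B / eps * kappa) (L1 * kappa) (r * `|s|).
by move=> *; lra.
Qed.

(** [near_slope] controls the slope with velocities taken at [y j], whereas [dE j x] has them at
    [x]. The exchange costs [L * N * Q (y j) x / eps], and near-minimality makes [Q (y j) x / eps]
    itself small. *)
Lemma near_dcost j x : E j x <= h x + delta ->
  `|dE j x| <= r + taylor_const * sigma / (2 * eps) + 2 * delta / sigma +
    4 * L * N * (N * L1 ^+ 2 * eps + 2 * delta).
Proof.
move=> hj; set P := \sum_k (f k (y j) - f k x) * f' k (y j).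
have h1 : `|P / eps| <= r + taylor_const * sigma / (2 * eps) + 2 * delta / sigma.
  (* Steps forward and backward in time bound both signs; division by [sigma] turns the error
     [2 * delta] into [2 * delta / sigma]. *)
  have n1 := near_slope sigma hj; have n2 := near_slope (- sigma) hj.
  rewrite -/P sqrrN normrN (gtr0_norm sigma0) in n1 n2.
  rewrite -(ler_pM2l sigma0) -{1}(gtr0_norm sigma0) -normrM.
  have -> : sigma * (r + taylor_const * sigma / (2 * eps) + 2 * delta / sigma) =
     r * sigma + taylor_const * sigma ^+ 2 / (2 * eps) + 2 * delta.
    by field; rewrite !gt_eqF.
  rewrite ler_norml; apply/andP; split.
    rewrite lerNl; apply: le_trans n1; rewrite le_eqVlt; apply/orP; left; apply/eqP; ring.
  apply: le_trans n2; rewrite le_eqVlt; apply/orP; left; apply/eqP; ring.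
have h2 : `|dE j x + P / eps| <= L * N * Q (y j) x / eps.
  have -> : dE j x + P / eps = (\sum_k (f k (y j) - f k x) * (f' k (y j) - f' k x)) / eps.
    rewrite /dcost mulrC -mulNr -mulrDl; congr (_ * _).
    by rewrite addrC -sumrB; apply: eq_bigr => k _; rewrite mulrBr.
  rewrite normrM normfV (gtr0_norm eps0) ler_pM2r ?invr_gt0 //.
  apply: le_trans (ler_norm_sum _ _ _) _.
  apply: (@le_trans _ _ (L * rho (y j) x ^+ 2)); last first.
    by rewrite -mulrA ler_wpM2l // sqr_rho.
  rewrite expr2 mulrCA {1}/rho mulr_suml; apply: ler_sum => k _.
  by rewrite normrM ler_wpM2l.
(* Near-minimality bounds [Q / (2 * eps)] by the drop of [V] plus [2 * delta], and half of it is
   absorbed by [lip_qdist]. *)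
have h3 : Q (y j) x / eps <= 4 * (N * L1 ^+ 2 * eps + 2 * delta).
  have u := softmin_upper x; move: hj; rewrite /cost /= => hj.
  have v := V_lip x (y j); rewrite rhoC in v.
  have w := lip_qdist (y j) x eps0.
  have e1 : Q (y j) x / (2 * eps) = Q (y j) x / eps / 2.
    by field; rewrite gt_eqF.
  have e2 : Q (y j) x / (4 * eps) = Q (y j) x / eps / 4.
    by field; rewrite gt_eqF.
  rewrite e1 in hj; rewrite e2 in w; lra.
have -> : dE j x = (dE j x + P / eps) - P / eps by rewrite addrK.
apply: le_trans (ler_normB _ _) _; rewrite addrC; apply: lerD => //.
apply: le_trans h2 _; rewrite -mulrA.
have -> : 4 * L * N * (N * L1 ^+ 2 * eps + 2 * delta) =
  L * N * (4 * (N * L1 ^+ 2 * eps + 2 * delta)) by ring.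
by rewrite ler_wpM2l // mulr_ge0.
Qed.

(** A crude bound, enough for net points far from minimal because their weights are tiny. *)
Lemma dcost_bound j x : `|dE j x| <= 2 * N * B ^+ 2 / eps.
Proof.
rewrite /dcost normrN normrM normfV (gtr0_norm eps0) mulrC ler_pM2r ?invr_gt0 //.
apply: le_trans (ler_norm_sum _ _ _) _.
have -> : 2 * N * B ^+ 2 = \sum_(k : I) 2 * B * B.
  by rewrite sumr_const -(mulr_natl _ #|I|); ring.
by apply: ler_sum => k _; rewrite normrM ler_pM // norm_sub_le.
Qed.

(** Near-minimal indices contribute at most [b], as the weights sum to 1. Any other weight is below
    [exp (- lam delta)], hence below [1 / (1 + lam delta)], which beats the crude bound; each such
    index may use [e / #|J|]. *)
Lemma softmin_slope (e b : R) x : 0 <= b ->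
  (forall j, E j x <= h x + delta -> `|dE j x| <= b) ->
  #|J|%:R * (2 * N * B ^+ 2 / eps) <= e * (1 + lam * delta) ->
  `|\sum_j expR (- lam * (E j x - h x)) * dE j x| <= b + e.
Proof.
move=> b0 hb hJ.
have J0 : 0 < #|J|%:R :> R by rewrite ltr0n; apply/card_gt0P; exists j0.
have ld : 0 < 1 + lam * delta by rewrite ltr_pwDl // mulr_ge0 // ltW.
have D0 : 0 <= 2 * N * B ^+ 2 / eps by rewrite divr_ge0 ?mulr_ge0 ?sqr_ge0 // ltW.
have e0 : 0 <= e by rewrite -(pmulr_lge0 _ ld) (le_trans _ hJ) // mulr_ge0 // ltW.
apply: le_trans (ler_norm_sum _ _ _) _.
apply: (@le_trans _ _ (\sum_j (expR (- lam * (E j x - h x)) * b + e / #|J|%:R))); last first.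
  rewrite big_split /= -mulr_suml (softmin_weight_sum _ j0) // mul1r sumr_const.
  by rewrite -(mulr_natl _ #|J|) mulrCA divff ?mulr1 // gt_eqF.
apply: ler_sum => j _; rewrite normrM ger0_norm ?expR_ge0 //.
have [hj|hj] := leP (E j x) (h x + delta).
  apply: (@le_trans _ _ (expR (- lam * (E j x - h x)) * b)).
    by rewrite ler_wpM2l ?expR_ge0 // hb.
  by rewrite lerDl divr_ge0 // ltW.
apply: (@le_trans _ _ (e / #|J|%:R)); last by rewrite lerDr mulr_ge0 ?expR_ge0.
have hw : expR (- lam * (E j x - h x)) <= (1 + lam * delta)^-1.
  rewrite mulNr expRN lef_pV2 ?posrE ?expR_gt0 //.
  apply: le_trans (expR_ge1Dx _) _; rewrite ler_expR ler_pM2l //.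
  by rewrite lerBrDl ltW.
apply: (@le_trans _ _ ((1 + lam * delta)^-1 * (2 * N * B ^+ 2 / eps))).
  by apply: ler_pM; rewrite ?expR_ge0 ?dcost_bound.
rewrite ler_pdivlMr // -[leLHS]mulrA ler_pdivrMl //.
by rewrite mulrC [leRHS]mulrC.
Qed.

End Bounds.

(** The order of choices matters: [sigma] is divided by [eps], [delta] by [sigma], and [kappa] must
    be small against [eps] and [delta]. Only then is the net, hence [#|J|], known, and [lam] is
    taken large against it. *)
Lemma smoothing (e : R) (x0 : M) : 0 < e ->
  exists (J : finType) (j0 : J) (lam eps : R) (a : J -> R) (y : J -> M),
    [/\ 0 < lam, 0 < eps, forall x, V x - e <= softmin f lam eps a y x <= V x + e &
      forall x, exists2 D, `|D| <= r + e &
        is_derive (0 : R) 1 (fun s => softmin f lam eps a y (g s x)) D].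
Proof.
move=> e0; have e8 : 0 < e / 8 by rewrite divr_gt0.
have Nge : 0 <= N by [].
have [eps [eps0 _ heps]] := @pos_small R (N * L1 ^+ 2 + 4 * L * N * (N * L1 ^+ 2)) (e / 8)
  (addr_ge0 (mulr_ge0 Nge (sqr_ge0 _)) (mulr_ge0 (mulr_ge0 (mulr_ge0 (ler0n _ _) L0) Nge)
    (mulr_ge0 Nge (sqr_ge0 _)))) e8.
have c1 : 0 <= taylor_const / (2 * eps).
  by rewrite divr_ge0 ?taylor_const_ge0 // mulr_ge0 // ltW.
have [sigma [sigma0 _ hsigma]] := pos_small c1 e8.
have c2 : 0 <= 2 / sigma + 8 * L * N + 1.
  by rewrite !addr_ge0 ?mulr_ge0 // invr_ge0 ltW.
have [delta [delta0 _ hdelta]] := pos_small c2 e8.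
have c3 : 0 <= L1 + 2 * B / eps + (2 * eps)^-1.
  by rewrite !addr_ge0 ?mulr_ge0 ?invr_ge0 ?mulr_ge0 // ltW.
have [kappa [kappa0 kappa1 hkappa]] := pos_small c3 delta0.
have [J [j0 [y net]]] := rho_net x0 hB kappa0.
have J0 : 0 < #|J|%:R :> R by rewrite ltr0n; apply/card_gt0P; exists j0.
set D := 2 * N * B ^+ 2 / eps.
have D0 : 0 <= D by rewrite divr_ge0 ?mulr_ge0 ?sqr_ge0 // ltW.
(* The first summand serves [softmin_lower], the second [softmin_slope], each with error [e / 2]. *)
pose lam := #|J|%:R / (e / 2) + #|J|%:R * D / (e / 2 * delta).
have e20 : 0 < e / 2 by rewrite divr_gt0.
have lamA : #|J|%:R / (e / 2) <= lam.
  by rewrite lerDl divr_ge0 // mulr_ge0 // ?(ltW e20) ?(ltW delta0).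
have lamB : #|J|%:R * D / (e / 2 * delta) <= lam.
  by rewrite lerDr divr_ge0 // (ltW e20).
have lam0 : 0 < lam by apply: lt_le_trans lamA; rewrite divr_gt0.
have p1 : 0 <= N * L1 ^+ 2 * eps by rewrite !mulr_ge0 ?sqr_ge0 // ltW.
have p2 : 0 <= 4 * L * N * (N * L1 ^+ 2 * eps) by rewrite !mulr_ge0 ?sqr_ge0 // ltW.
have p3 : 0 <= 8 * L * N * delta by rewrite !mulr_ge0 // ltW.
have p4 : 0 <= 2 * delta / sigma by rewrite divr_ge0 ?mulr_ge0 // ltW.
have p5 : 0 <= L1 * kappa by rewrite mulr_ge0 // ltW.
have p6 : 0 <= 2 * B / eps * kappa by rewrite !mulr_ge0 ?invr_ge0 // ltW.
have p7 : kappa ^+ 2 / (2 * eps) <= (2 * eps)^-1 * kappa.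
  rewrite mulrC ler_wpM2l ?invr_ge0 ?mulr_ge0 ?(ltW eps0) // expr2.
  by rewrite ler_piMr // ltW.
have p8 : 0 <= (2 * eps)^-1 * kappa by rewrite mulr_ge0 ?invr_ge0 ?mulr_ge0 // ltW.
have p9 : 0 <= delta by exact: ltW.
have {}heps : N * L1 ^+ 2 * eps + 4 * L * N * (N * L1 ^+ 2 * eps) <= e / 8.
  by apply: le_trans heps; rewrite le_eqVlt; apply/orP; left; apply/eqP; ring.
have {}hdelta : 2 * delta / sigma + 8 * L * N * delta + delta <= e / 8.
  by apply: le_trans hdelta; rewrite le_eqVlt; apply/orP; left; apply/eqP; ring.
have {}hkappa : L1 * kappa + 2 * B / eps * kappa + (2 * eps)^-1 * kappa <= delta.
  by apply: le_trans hkappa; rewrite le_eqVlt; apply/orP; left; apply/eqP; ring.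
have hk1 : L1 * kappa + 2 * B / eps * kappa <= delta by lra.
have hk2 : L1 * kappa + kappa ^+ 2 / (2 * eps) <= delta by lra.
exists J, j0, lam, eps, (V \o y), y; split=> //.
  move=> x; apply/andP; split; last first.
    by apply: le_trans (softmin_upper j0 lam0 eps0 kappa0 net hk2 x) _; lra.
  have hJ : #|J|%:R <= 1 + lam * (e / 2).
    have : #|J|%:R <= lam * (e / 2) by rewrite -ler_pdivrMr.
    lra.
  by apply: le_trans (softmin_lower j0 y lam0 eps0 x hJ); lra.
move=> x.
set b := r + taylor_const * sigma / (2 * eps) + 2 * delta / sigma +
    4 * L * N * (N * L1 ^+ 2 * eps + 2 * delta).
have hb : b <= r + e / 2.
  rewrite /b (_ : taylor_const * sigma / (2 * eps) =
    taylor_const / (2 * eps) * sigma); last by ring.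
  rewrite (_ : 4 * L * N * (N * L1 ^+ 2 * eps + 2 * delta) =
    4 * L * N * (N * L1 ^+ 2 * eps) + 8 * L * N * delta); last by ring.
  lra.
have b0 : 0 <= b.
  rewrite /b; have := mulr_ge0 c1 (ltW sigma0).
  rewrite (_ : taylor_const / (2 * eps) * sigma = taylor_const * sigma / (2 * eps)); last by ring.
  rewrite (_ : 4 * L * N * (N * L1 ^+ 2 * eps + 2 * delta) =
    4 * L * N * (N * L1 ^+ 2 * eps) + 8 * L * N * delta); last by ring.
  by move=> ?; rewrite !addr_ge0.
exists (\sum_j expR (- lam * (cost f eps (V \o y) y j x - softmin f lam eps (V \o y) y x)) *
   dcost f f' eps y j x); last first.
  rewrite -{2 3 4}(g0 x).
  have := @is_derive_softmin R M I f f' J j0 lam eps (V \o y) y lam0 eps0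
    (fun s => g s x) 0.
  rewrite !g0; apply=> k; have := der k x 0; by rewrite g0.
apply: (@le_trans _ _ (b + e / 2)); last by lra.
apply: (softmin_slope j0 lam0 eps0 (ltW delta0)) => //.
  by move=> j; exact: (near_dcost j0 lam0 eps0 kappa0 sigma0 net hk1 hk2).
have : #|J|%:R * D <= lam * (e / 2 * delta) by rewrite -ler_pdivrMr // mulr_gt0.
rewrite -/D; lra.
Qed.

End Smoothing.

(** * Smooth functions on a manifold *)

Section Charts.
Context {R : realType} {d : nat} {M : topologicalType}.
Implicit Types (c : chart R d M).

Lemma cimg_cmap c x : cdom c x -> cimg c (cmap c x).
Proof. by move=> hx; exists x. Qed.

Lemma cdom_cinv c y : cimg c y -> cdom c (cinv c y).
Proof. by move=> [x hx <-]; rewrite cmapK. Qed.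

Lemma cinvK c y : cimg c y -> cmap c (cinv c y) = y.
Proof. by move=> [x hx <-]; rewrite cmapK. Qed.

Lemma open_chart_preimage c (O : set M) : open O -> open (cimg c `&` cinv c @^-1` O).
Proof.
move=> oO; rewrite openE => y [iy Oy]; rewrite /interior.
have hO : \forall z \near y, O (cinv c z).
  exact: (cinv_continuous iy (open_nbhs_nbhs (conj oO Oy))).
near=> z; split; last by near: z.
by near: z; apply: open_nbhs_nbhs; split=> //; exact: cimg_open.
Unshelve. all: by end_near. Qed.

Lemma transition_domE c c' :
  cmap c @` (cdom c `&` cdom c') = cimg c `&` cinv c @^-1` (cdom c').
Proof.
apply/seteqP; split=> y.
  by move=> [x [h1 h2] <-]; split; [exact: cimg_cmap|rewrite /= cmapK].
by move=> [iy h]; exists (cinv c y); [split=> //; exact: cdom_cinv|exact: cinvK].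
Qed.

Lemma transition_dom_open c c' : open (cmap c @` (cdom c `&` cdom c')).
Proof. by rewrite transition_domE; apply: open_chart_preimage; exact: cdom_open. Qed.

Lemma compact_cinv_box c a r : box a r `<=` cimg c -> compact (cinv c @` box a r).
Proof.
move=> hb; apply: continuous_compact; last exact: compact_box.
by apply: continuous_in_subspaceT => y; rewrite inE => /hb; exact: cinv_continuous.
Qed.

Lemma open_box (U : set 'rV[R]_d) y : open U -> U y ->
  exists2 r, 0 < r & box y r `<=` U.
Proof.
move=> oU Uy; have /nbhs_ballP[r /= r0 hr] : nbhs y U by exact: open_nbhs_nbhs.
exists (r / 2); first by rewrite divr_gt0.
move=> z hz; apply: hr; rewrite -ball_normE /=; apply: norm_lt_coord => // i.
rewrite !mxE distrC (le_lt_trans (hz i)) // ltr_pdivrMr // ltr_pMr //.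
by rewrite ltr1n.
Qed.

End Charts.

Section SmoothFunctions.
Context {R : realType} {d : nat} {M : topologicalType} (A : manifold R d M).
Implicit Types (F G : M -> R) (c : chart R d M).

Lemma smooth_cst (k : R) : smooth A (fun=> k).
Proof. by move=> c _; exact: smooth_on_cst. Qed.

Lemma smoothD F G : smooth A F -> smooth A G -> smooth A (fun x => F x + G x).
Proof.
move=> sF sG c hc; apply: (@smooth_onD R d R (cimg c) (F \o cinv c) (G \o cinv c)).
- exact: cimg_open.
- exact: sF.
- exact: sG.
Qed.

Lemma smoothM F G : smooth A F -> smooth A G -> smooth A (fun x => F x * G x).
Proof.
move=> sF sG c hc; apply: (@smooth_onM R d (cimg c) (F \o cinv c) (G \o cinv c)).
- exact: cimg_open.
- exact: sF.
- exact: sG.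
Qed.

Lemma smoothZ k F : smooth A F -> smooth A (fun x => k * F x).
Proof. by move=> sF; exact: (smoothM (smooth_cst k) sF). Qed.

Lemma smooth_cstB k F : smooth A F -> smooth A (fun x => k - F x).
Proof.
move=> sF; have -> : (fun x => k - F x) = (fun x => k + (-1) * F x).
  by apply/funext => x; rewrite mulN1r.
exact: (smoothD (smooth_cst k) (smoothZ (-1) sF)).
Qed.

Lemma smooth_sum (I : Type) (r : seq I) (F : I -> M -> R) :
  (forall i, smooth A (F i)) -> smooth A (fun x => \sum_(i <- r) F i x).
Proof.
move=> sF c hc; apply: (@smooth_on_sum R d I r (fun i => F i \o cinv c) (cimg c)).
- exact: cimg_open.
- by move=> i; exact: sF.
Qed.

Lemma smooth_inv F : (forall x, F x != 0) -> smooth A F -> smooth A (fun x => (F x)^-1).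
Proof.
move=> F0 sF c hc; apply: (@smooth_on_inv R d (cimg c) (F \o cinv c)).
- exact: cimg_open.
- by move=> y _; exact: F0.
- exact: sF.
Qed.

Lemma smooth_expR F : smooth A F -> smooth A (fun x => expR (F x)).
Proof.
move=> sF c hc; apply: (@smooth_on_expR R d (cimg c) (F \o cinv c)).
- exact: cimg_open.
- exact: sF.
Qed.

Lemma smooth_ln F : (forall x, 0 < F x) -> smooth A F -> smooth A (fun x => ln (F x)).
Proof.
move=> F0 sF c hc; apply: (@smooth_on_ln R d (cimg c) (F \o cinv c)).
- exact: cimg_open.
- by move=> y _; exact: F0.
- exact: sF.
Qed.

Lemma smooth_flat F : smooth A F -> smooth A (fun x => flat 0 (F x)).
Proof.
move=> sF c hc; apply: (@smooth_on_flat R d (cimg c) (F \o cinv c)).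
- exact: cimg_open.
- exact: sF.
Qed.

Lemma smooth_softmin (I J : finType) (f : I -> M -> R) (lam eps : R) (a : J -> R)
    (y : J -> M) (j0 : J) :
  (forall k, smooth A (f k)) -> smooth A (softmin f lam eps a y).
Proof.
move=> sf; rewrite /softmin.
have sq j : smooth A (fun x => qdist f (y j) x).
  apply: smooth_sum => k.
  have -> : (fun x => (f k (y j) - f k x) ^+ 2) =
    (fun x => (f k (y j) - f k x) * (f k (y j) - f k x)).
    by apply/funext => x; rewrite expr2.
  by have s1 := smooth_cstB (f k (y j)) (sf k); exact: (smoothM s1 s1).
have sS : smooth A (fun x => \sum_j expR (- lam * cost f eps a y j x)).
  apply: smooth_sum => j; apply: smooth_expR; apply: smoothZ.
  exact: (smoothD (smooth_cst (a j)) (smoothM (sq j) (smooth_cst _))).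
have -> : (fun x => - (lam^-1 * ln (\sum_j expR (- lam * cost f eps a y j x)))) =
  (fun x => (- lam^-1) * ln (\sum_j expR (- lam * cost f eps a y j x))).
  by apply/funext => x; rewrite mulNr.
apply: smoothZ.
apply: smooth_ln sS => x.
by rewrite (bigD1 j0) //= ltr_pwDl ?expR_gt0 // sumr_ge0 // => j _; exact: expR_ge0.
Qed.

Lemma smooth_continuous F : smooth A F -> continuous F.
Proof.
move=> sF x; have hx := mem_chart_at A x; set c := chart_at A x.
have sc := sF c (chart_at_atlas A x).
apply: (@eq_for_continuous _ _ ((F \o cinv c) \o cmap c)).
  near=> z; rewrite /= cmapK //.
  by near: z; apply: open_nbhs_nbhs; split=> //; exact: cdom_open.
apply: continuous_comp; first exact: cmap_continuous.
by apply: (smooth_on_cont sc); exact: cimg_cmap.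
Unshelve. all: by end_near. Qed.

Definition chart_ext c (b : 'rV[R]_d -> R) (x : M) : R :=
  if `[< cdom c x >] then b (cmap c x) else 0.

Lemma chart_extE c b x : cdom c x -> chart_ext c b x = b (cmap c x).
Proof. by move=> hx; rewrite /chart_ext asboolT. Qed.

Lemma chart_ext_out c b a r x : (forall y, ~ box a r y -> b y = 0) ->
  ~ (cinv c @` box a r) x -> chart_ext c b x = 0.
Proof.
move=> hb hx; rewrite /chart_ext; case: asboolP => // dx; apply: hb => hbox; apply: hx.
by exists (cmap c x) => //; exact: cmapK.
Qed.

(** [M] is covered by the chart domain, where a transition map applies, and by the complement of the
    compact image of the box, which is open as [M] is Hausdorff and where the function is 0.
    Smoothness of [b] is asked as stability under precomposition, which bump functions satisfy
    coordinate by coordinate. *)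
Lemma smooth_chart_ext c b a r : atlas A c -> box a r `<=` cimg c ->
  (forall y, ~ box a r y -> b y = 0) ->
  (forall U (t : 'rV[R]_d -> 'rV[R]_d), open U -> smooth_on U t ->
     smooth_on U (b \o t)) ->
  smooth A (chart_ext c b).
Proof.
move=> hc hbox b0 hb c' hc'; apply: smooth_on_local => y iy.
have [dx|ndx] := pselect (cdom c (cinv c' y)).
  exists (cmap c' @` (cdom c' `&` cdom c)); split.
    by rewrite transition_domE.
  have oU := @transition_dom_open R d M c' c.
  apply: (@eq_smooth_on R d R _ (b \o (cmap c \o cinv c'))) => //.
    by move=> z; rewrite transition_domE => -[_ dz]; rewrite /= chart_extE.
  by apply: hb => //; exact: (atlas_compatible hc' hc).
exists (cimg c' `&` cinv c' @^-1` (~` (cinv c @` box a r))).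
have oV : open (cimg c' `&` cinv c' @^-1` (~` (cinv c @` box a r))).
  apply: open_chart_preimage; apply: closed_openC.
  apply: compact_closed; first exact: (manifold_hausdorff A).
  exact: compact_cinv_box.
split.
  split=> // -[z hz hzy]; apply: ndx; rewrite -hzy; apply: cdom_cinv; exact: hbox.
apply: (@eq_smooth_on R d R _ (fun=> 0)) => //; last exact: smooth_on_cst.
by move=> z [_ hz]; rewrite /= (chart_ext_out b0).
Qed.

Lemma compact_support_sub (K : set M) F : compact K -> (forall x, ~ K x -> F x = 0) ->
  compact (closure [set x | F x != 0]).
Proof.
move=> cK hK; have clK : closed K by apply: compact_closed => //; exact: (manifold_hausdorff A).
apply: (subclosed_compact _ cK); first exact: closed_closure.
rewrite [X in _ `<=` X]((closure_id K).1 clK); apply: closureS => x /= /eqP Fx.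
by apply: contrapT => /hK.
Qed.

Lemma bounded_off_compact (K : set M) F : compact K -> (forall x, ~ K x -> F x = 0) ->
  continuous F -> exists2 B, 0 <= B & forall x, `|F x| <= B.
Proof.
move=> cK hK cF.
have /compact_bounded/ex_strict_bound_gt0[C C0 hC] : compact (F @` K).
  by apply: continuous_compact => //; exact: continuous_subspaceT.
exists C; first exact: ltW.
move=> x; have [Kx|/hK ->] := pselect (K x); last by rewrite normr0 ltW.
by apply/ltW/hC; exists x.
Qed.

End SmoothFunctions.

(** * The Poisson bracket in coordinates *)

Section Determinant.
Context {R : realType} {d : nat}.

Lemma smooth_on_det n (U : set 'rV[R]_d) (B : 'rV[R]_d -> 'M[R]_n) : open U ->
  (forall i j, smooth_on U (fun y => B y i j : R)) -> smooth_on U (fun y => \det (B y)).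
Proof.
move=> oU sB; apply: (@smooth_on_sum R d _ _
  (fun (s : {perm 'I_n}) y => (-1) ^+ s * \prod_i B y i (s i)) U oU) => s.
apply: (@smooth_onM R d U (fun=> (-1) ^+ s)) => //; first exact: (@smooth_on_cst R d R).
by apply: (@smooth_on_prod R d _ _ (fun i y => B y i (s i)) U oU) => i.
Qed.

(** Cramer's rule: cofactors are polynomial in the entries, and the determinant does not vanish. *)
Lemma smooth_on_invmx n (U : set 'rV[R]_d) (B : 'rV[R]_d -> 'M[R]_n) i j : open U ->
  (forall y, U y -> B y \in unitmx) ->
  (forall i j, smooth_on U (fun y => B y i j : R)) ->
  smooth_on U (fun y => invmx (B y) i j : R).
Proof.
move=> oU uB sB.
have E y : U y -> (\det (B y))^-1 * ((-1) ^+ (j + i) * \det (row' j (col' i (B y)))) =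
    invmx (B y) i j.
  by move=> Uy; rewrite /invmx uB // !mxE.
apply: (@eq_smooth_on R d R U _ _ oU E).
apply: (smooth_onM oU).
  apply: (smooth_on_inv oU); last exact: smooth_on_det.
  by move=> y /uB; rewrite unitmxE unitfE.
apply: (@smooth_onM R d U (fun=> (-1) ^+ (j + i))) => //.
  exact: (@smooth_on_cst R d R).
apply: smooth_on_det => // k l.
have -> : (fun y => row' j (col' i (B y)) k l : R) = (fun y => B y (lift j k) (lift i l)).
  by apply/funext => y; rewrite !mxE.
exact: sB.
Qed.

End Determinant.

Lemma mulmx_tr_delta {R : comPzRingType} {d : nat} (B C : 'M[R]_d) (u : 'rV[R]_d) j :
  (u *m B *m ((delta_mx 0 j : 'rV_d) *m C)^T) 0 0 = (u *m B *m C^T) 0 j.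
Proof. by rewrite trmx_mul trmx_delta mulmxA -colE mxE. Qed.

Section Symplectic.
Context {R : realType} {d : nat} {M : topologicalType} (A : manifold R d M).
Implicit Types (F G : M -> R) (c : chart R d M).

Lemma smooth_differentiable F c y : smooth A F -> atlas A c -> cimg c y ->
  differentiable (F \o cinv c : 'rV[R]_d -> R) y.
Proof.
by move=> sF hc iy; exact: (smooth_on_differentiable (cimg_open (c := c)) (sF c hc) iy).
Qed.

Lemma transition_differentiable c c' y : atlas A c -> atlas A c' ->
  cimg c y -> cdom c' (cinv c y) -> differentiable (cmap c' \o cinv c) y.
Proof.
move=> hc hc' iy dy.
have Uy : (cmap c @` (cdom c `&` cdom c')) y by rewrite transition_domE.
exact: (smooth_on_differentiable_row (transition_dom_open (c := c) (c' := c'))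
  (atlas_compatible hc hc') Uy).
Qed.

Lemma differential_lin F x (v : 'rV[R]_d) : smooth A F ->
  differential A F (v : tangent x) =
  'd (F \o cinv (chart_at A x) : 'rV[R]_d -> R) (cmap (chart_at A x) x) v.
Proof.
move=> sF; rewrite /differential deriveE //.
apply: smooth_differentiable => //; first exact: chart_at_atlas.
apply: cimg_cmap; exact: mem_chart_at.
Qed.

(** The chain rule in the chart at [g t x]; continuity of the trajectory keeps it in the chart
    domain for times near [t]. *)
Lemma flow_derive (X : forall x : M, tangent x) (g : R -> M -> M) F x (t : R) :
  is_flow A X g -> smooth A F ->
  is_derive t 1 (fun s => F (g s x)) (differential A F (X (g t x))).
Proof.
move=> hg sF; have [_ cg /(_ t) dg] := hg x.
set z := g t x in dg *; set c := chart_at A z in dg *.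
have hz : cdom c z by exact: mem_chart_at.
have hc : atlas A c by exact: chart_at_atlas.
apply: (@near_eq_is_derive R R R ((F \o cinv c) \o (fun s => cmap c (g s x)))).
  have : \forall s \near t, cdom c (g s x).
    by apply: (cg t); apply: open_nbhs_nbhs; split=> //; exact: cdom_open.
  by apply: filterS => s hs; rewrite /= cmapK.
have [dg1 dg2] := dg.
apply: (@is_derive_comp R _ _ _ (F \o cinv c) (fun s => cmap c (g s x)) t 1 (X z)) => //.
  by apply: smooth_differentiable => //; exact: cimg_cmap.
exact/derivable1_diffP.
Qed.

Lemma differential_eq0 F x (O : set M) (v : tangent x) : open O -> O x ->
  (forall z, O z -> F z = 0) -> differential A F v = 0.
Proof.
move=> oO Ox hF; rewrite /differential; set c := chart_at A x.
have hx : cdom c x by exact: mem_chart_at.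
rewrite (@near_eq_derive R _ _ _ (fun=> 0)); first exact: derive_cst.
have oV := open_chart_preimage (c := c) oO.
apply: (near_open oV); first by split; [exact: cimg_cmap|rewrite /= cmapK].
by move=> z [_ hz]; exact: hF.
Qed.

Section Jacobian.
Context (c : chart R d M) (y : 'rV[R]_d) (hc : atlas A c) (iy : cimg c y).
Local Notation x := (cinv c y).
Local Notation c0 := (chart_at A x).

(** Row [i] is the coordinate vector [coord_vec A c y i] written in the preferred chart at [x]. *)
Definition chart_jac : 'M[R]_d := 'J (cmap c0 \o cinv c) y.

Lemma chart_at_dom : cdom c0 x. Proof. exact: mem_chart_at. Qed.

Lemma transition_diff0 : differentiable (cmap c0 \o cinv c) y.
Proof.
by apply: transition_differentiable => //; [exact: chart_at_atlas|exact: chart_at_dom].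
Qed.

Lemma coord_vecE i : coord_vec A c y i = delta_mx 0 i *m chart_jac.
Proof. by rewrite /coord_vec deriveEjacobian //; exact: transition_diff0. Qed.

(** The Jacobian of the reverse transition is an inverse, since the composite is the identity near
    [y]. *)
Lemma chart_jac_unit : chart_jac \in unitmx.
Proof.
pose s := cmap c \o cinv c0.
have is0 : cimg c0 (cmap c0 x) by apply: cimg_cmap; exact: chart_at_dom.
have dt := transition_diff0.
have ds : differentiable s (cmap c0 x).
  apply: transition_differentiable => //; first exact: chart_at_atlas.
  by rewrite cmapK; [exact: cdom_cinv|exact: chart_at_dom].
pose J2 : 'M[R]_d := 'J s (cmap c0 x).
suff h : chart_jac *m J2 = 1%:M by have [hu _] := mulmx1_unit h.
apply/row_matrixP => i; rewrite !rowE mulmx1 mulmxA.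
have e1 : delta_mx 0 i *m chart_jac = 'D_(delta_mx 0 i) (cmap c0 \o cinv c) y.
  by rewrite deriveEjacobian.
have [_ e2] := @is_derive_comp R _ _ _ s (cmap c0 \o cinv c) y (delta_mx 0 i) _ ds dt (esym e1).
rewrite -deriveEjacobian // -e2.
rewrite (@near_eq_derive R _ _ _ id); first exact: derive_id.
have oV := transition_dom_open (c := c) (c' := c0).
apply: (near_open oV).
  by rewrite transition_domE; split => //; exact: chart_at_dom.
move=> z; rewrite transition_domE => -[iz dz]; rewrite /s /= cmapK //.
exact: cinvK.
Qed.

Lemma differential_coord_vec F i : smooth A F ->
  differential A F (coord_vec A c y i) = 'D_(basis_vec i) (F \o cinv c : 'rV[R]_d -> R) y.
Proof.
move=> sF.
have dF : differentiable (F \o cinv c0 : 'rV[R]_d -> R) (cmap c0 x).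
  apply: smooth_differentiable => //; first exact: chart_at_atlas.
  by apply: cimg_cmap; exact: chart_at_dom.
have [_ e] := @is_derive_comp R _ _ _ (F \o cinv c0) (cmap c0 \o cinv c) y
  (basis_vec i) _ dF transition_diff0 erefl.
rewrite /differential /coord_vec -e; apply: near_eq_derive.
have oV := transition_dom_open (c := c) (c' := c0).
apply: (near_open oV).
  by rewrite transition_domE; split => //; exact: chart_at_dom.
by move=> z; rewrite transition_domE => -[iz dz]; rewrite /= cmapK.
Qed.

End Jacobian.

Context (w : @bilin_field R d M) (hw : symplectic A w).

Lemma form_unit x : w x \in unitmx.
Proof.
rewrite -row_free_unit -kermx_eq0; apply/eqP/row_matrixP => i; rewrite row0.
apply: (symplectic_nondeg hw (x := x)) => v.
have := row_mul i (kermx (w x)) (w x); rewrite mulmx_ker row0 => h.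
by rewrite /Defs.form -h mul0mx mxE.
Qed.

(** As [sgrad] is an [xget], its equation holds once a solution exists; the inverse Gram matrix
    provides one. *)
Lemma sgradE F x (v : tangent x) : smooth A F ->
  Defs.form w (sgrad A w F x) v = - differential A F v.
Proof.
move=> sF.
suff h : exists X : 'rV[R]_d, forall v : tangent x,
    Defs.form w (X : tangent x) v = - differential A F v.
  exact: (xgetPex 0 h v).
pose gr : 'rV[R]_d := \row_i differential A F (delta_mx 0 i : tangent x).
exists (- gr *m invmx (w x)) => u.
rewrite /Defs.form mulmxKV ?form_unit // mulNmx mxE differential_lin //.
congr (- _); rewrite {2}[u]row_sum_delta linear_sum mxE.
apply: eq_bigr => i _; rewrite linearZ /= !mxE differential_lin //.
by rewrite /GRing.scale /= mulrC.
Qed.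

(** Skew-symmetry makes the bracket the derivative of [F] along the flow of [G]. *)
Lemma poissonE F G x : smooth A F -> smooth A G ->
  poisson A w F G x = differential A F (sgrad A w G x).
Proof.
move=> sF sG.
by rewrite /poisson (symplectic_skew hw) sgradE // opprK.
Qed.

Lemma sgrad_eq0 G x (O : set M) : smooth A G -> open O -> O x ->
  (forall z, O z -> G z = 0) -> sgrad A w G x = (0 : 'rV[R]_d).
Proof.
move=> sG oO Ox hG; apply: (symplectic_nondeg hw (x := x)) => v.
by rewrite sgradE // (differential_eq0 v oO Ox hG) oppr0.
Qed.

Lemma poisson_eq0 F G x (O : set M) : smooth A F -> smooth A G -> open O -> O x ->
  (forall z, O z -> G z = 0) -> poisson A w F G x = 0.
Proof.
move=> sF sG oO Ox hG; rewrite poissonE // (sgrad_eq0 sG oO Ox hG).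
by rewrite differential_lin // linear0.
Qed.

Definition gram c (y : 'rV[R]_d) : 'M[R]_d := \matrix_(i, j) form_coord A w c i j y.

Lemma gramE c y : atlas A c -> cimg c y ->
  gram c y = chart_jac c y *m w (cinv c y) *m (chart_jac c y)^T.
Proof.
move=> hc iy; apply/matrixP => i j.
rewrite mxE /form_coord /Defs.form !coord_vecE // mulmx_tr_delta.
by rewrite -!mulmxA -rowE mxE.
Qed.

Lemma gram_unit c y : atlas A c -> cimg c y -> gram c y \in unitmx.
Proof.
move=> hc iy; rewrite gramE // !unitmx_mul unitmx_tr form_unit.
by rewrite chart_jac_unit.
Qed.

(** The preferred chart, and with it the matrix [w x], may jump with [x]. Smoothness of the bracket
    must therefore be read off in one fixed chart [c], where the Gram matrix is smooth. *)
Lemma poisson_coordE F G c y : smooth A F -> smooth A G -> atlas A c -> cimg c y ->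
  poisson A w F G (cinv c y) =
  - \sum_i (\sum_j 'D_(basis_vec j) (G \o cinv c : 'rV[R]_d -> R) y * invmx (gram c y) j i) *
     'D_(basis_vec i) (F \o cinv c : 'rV[R]_d -> R) y.
Proof.
move=> sF sG hc iy; rewrite poissonE //; set x := cinv c y.
set X : 'rV[R]_d := sgrad A w G x; set J := chart_jac c y.
have uJ : J \in unitmx by exact: chart_jac_unit.
pose gam : 'rV[R]_d := \row_j 'D_(basis_vec j) (G \o cinv c : 'rV[R]_d -> R) y.
have hX : X *m w x *m J^T = - gam.
  apply/rowP => j; have gj : gam 0 j = 'D_(basis_vec j) (G \o cinv c : 'rV[R]_d -> R) y.
    by rewrite mxE.
  rewrite [RHS]mxE gj -(differential_coord_vec hc iy j sG) -(sgradE _ sG) /Defs.form.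
  by rewrite coord_vecE // mulmx_tr_delta.
have uG := gram_unit hc iy.
(* The components of the Hamiltonian vector in the coordinate frame of [c]. *)
pose xi := X *m invmx J.
have xiE : xi = - gam *m invmx (gram c y).
  rewrite -hX gramE // -[X in X *m w x](mulmxKV uJ) -/xi -!(mulmxA xi) mulmxA.
  by rewrite -[RHS]mulmxA mulmxV ?mulmx1 // -gramE.
have XE : X = \sum_i xi 0 i *: coord_vec A c y i.
  rewrite -[X](mulmxKV uJ) -/xi {1}[xi]row_sum_delta mulmx_suml.
  by apply: eq_bigr => i _; rewrite coord_vecE // scalemxAl.
rewrite differential_lin // XE linear_sum -sumrN; apply: eq_bigr => i _.
rewrite linearZ /= -differential_lin // differential_coord_vec //.
rewrite /GRing.scale /= -mulNr; congr (_ * _).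
rewrite xiE mulNmx mxE mxE; congr (- _); apply: eq_bigr => j _.
by rewrite mxE.
Qed.

Lemma smooth_poisson F G : smooth A F -> smooth A G -> smooth A (poisson A w F G).
Proof.
move=> sF sG c hc.
have oU := cimg_open (c := c).
apply: (@eq_smooth_on R d R (cimg c) _ _ oU
  (fun y iy => esym (poisson_coordE sF sG hc iy))).
apply: (smooth_onN oU); apply: (smooth_on_sum (R := R) (d := d)) => // i.
apply: (@smooth_onM R d (cimg c)) => //; last first.
  exact: smooth_on_derive (sF c hc).
apply: (@smooth_on_sum R d _ _ (fun j y => 'D_(basis_vec j) (G \o cinv c : 'rV[R]_d -> R) y *
  invmx (gram c y) j i)) => // j.
apply: (@smooth_onM R d (cimg c)) => //.
  exact: smooth_on_derive (sG c hc).
apply: smooth_on_invmx => //.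
  by move=> y iy; exact: gram_unit.
move=> k l; have := symplectic_smooth hw hc k l.
by apply: eq_smooth_on => // y _; rewrite mxE.
Qed.

End Symplectic.

(** * Bump functions *)

Section Bump.
Context {R : realType} {d : nat}.
Implicit Types (a y : 'rV[R]_d) (r : R).

Lemma flat_ge0 m (x : R) : 0 <= flat m x.
Proof.
rewrite /flat; case: ifPn => // x0.
by rewrite mulr_ge0 ?expR_ge0 ?exprn_ge0 // invr_ge0 ltW.
Qed.

Lemma flat_gt0 (x : R) : 0 < x -> 0 < flat 0 x.
Proof. by move=> x0; rewrite /flat x0 expr0 mul1r expR_gt0. Qed.

Lemma flat_le0 m (x : R) : x <= 0 -> flat m x = 0.
Proof. by move=> x0; rewrite /flat ltNge x0. Qed.

Definition box_bump a r y : R := \prod_i flat 0 (r ^+ 2 - (y 0 i - a 0 i) ^+ 2).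

(** The Whitney functions of a chart: the bump ([None]) and its products with the coordinates
    ([Some j]), from which the coordinates are recovered by division. *)
Definition box_bump_coord a r (o : option 'I_d) y : R :=
  box_bump a r y * (if o is Some j then y 0 j else 1).

Lemma box_bump_ge0 a r y : 0 <= box_bump a r y.
Proof. by apply: prodr_ge0 => i _; exact: flat_ge0. Qed.

Lemma box_bump_center a r : 0 < r -> 0 < box_bump a r a.
Proof.
move=> r0; apply: prodr_gt0 => i _.
by rewrite subrr expr0n subr0 flat_gt0 // exprn_gt0.
Qed.

Lemma box_bump_out a r y : 0 < r -> ~ box a r y -> box_bump a r y = 0.
Proof.
move=> r0 /existsNP[i /negP]; rewrite -ltNge => hi.
apply/eqP; rewrite prodf_seq_eq0; apply/hasP; exists i; first exact: mem_index_enum.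
rewrite /= flat_le0 // subr_le0 -(real_normK (num_real (_ - _))).
by rewrite ler_pXn2r ?nnegrE // ltW.
Qed.

Lemma box_bump_coord_out a r o y : 0 < r -> ~ box a r y -> box_bump_coord a r o y = 0.
Proof. by move=> r0 hy; rewrite /box_bump_coord box_bump_out // mul0r. Qed.

Lemma smooth_box_bump_coord a r o (U : set 'rV[R]_d) (t : 'rV[R]_d -> 'rV[R]_d) :
  open U -> smooth_on U t -> smooth_on U (box_bump_coord a r o \o t).
Proof.
move=> oU st; have sc j := smooth_on_coord j oU st.
apply: (@smooth_onM R d U (box_bump a r \o t)
  (fun y => if o is Some j then t y 0 j else 1) oU); last first.
  by case: o => [j|]; [exact: sc|exact: (@smooth_on_cst R d R)].
apply: (@smooth_on_prod R d _ _
  (fun i y => flat 0 (r ^+ 2 - (t y 0 i - a 0 i) ^+ 2)) U oU) => i.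
apply: smooth_on_flat => //.
apply: (@smooth_onD R d R U (fun=> r ^+ 2) (fun y => - (t y 0 i - a 0 i) ^+ 2)) => //.
  exact: smooth_on_cst.
apply: smooth_onN => //.
have s1 : smooth_on U (fun y => t y 0 i + - a 0 i).
  by apply: (@smooth_onD R d R U (fun y => t y 0 i)) => //; exact: smooth_on_cst.
have -> : (fun y => (t y 0 i - a 0 i) ^+ 2) =
  (fun y => (t y 0 i + - a 0 i) * (t y 0 i + - a 0 i)).
  by apply/funext => y; rewrite expr2.
exact: smooth_onM.
Qed.

End Bump.

(** * Bump functions on the manifold as local embeddings *)

Section Embedding.
Context {R : realType} {d : nat} {M : topologicalType} (A : manifold R d M).
Context (r : M -> R) (r0 : forall a, 0 < r a)
  (hr : forall a, box (cmap (chart_at A a) a) (r a) `<=` cimg (chart_at A a)).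
Local Notation c a := (chart_at A a).
Local Notation ctr a := (cmap (chart_at A a) a).
Local Notation bx a := (box (ctr a) (r a)).

Definition chart_bump (a : M) (o : option 'I_d) : M -> R :=
  chart_ext (c a) (box_bump_coord (ctr a) (r a) o).

Definition chart_bump_supp (a : M) : set M := cinv (c a) @` bx a.

(** Above half of its central value the bump is bounded away from 0, so recovering coordinates by
    division is a Lipschitz operation. *)
Definition chart_bump_dom (a : M) : set M :=
  [set x | chart_bump a None a / 2 < chart_bump a None x].

Lemma smooth_chart_bump a o : smooth A (chart_bump a o).
Proof.
apply: (@smooth_chart_ext R d M A _ _ (ctr a) (r a)).
- exact: chart_at_atlas.
- exact: hr.
- by move=> y; exact: box_bump_coord_out.
- by move=> U t; exact: smooth_box_bump_coord.
Qed.

Lemma compact_chart_bump_supp a : compact (chart_bump_supp a).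
Proof. by apply: compact_cinv_box; exact: hr. Qed.

Lemma chart_bump_out a o x : ~ chart_bump_supp a x -> chart_bump a o x = 0.
Proof. by apply: chart_ext_out => y; exact: box_bump_coord_out. Qed.

Lemma chart_bump_ge0 a x : 0 <= chart_bump a None x.
Proof.
rewrite /chart_bump /chart_ext; case: asboolP => // _.
by rewrite /box_bump_coord mulr1 box_bump_ge0.
Qed.

Lemma chart_bump_center a : 0 < chart_bump a None a.
Proof.
rewrite /chart_bump chart_extE ?/box_bump_coord ?mulr1; first exact: box_bump_center.
exact: mem_chart_at.
Qed.

Lemma chart_bump_gt0 a x : 0 < chart_bump a None x ->
  [/\ cdom (c a) x, bx a (cmap (c a) x) &
    forall j, chart_bump a (Some j) x = chart_bump a None x * cmap (c a) x 0 j].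
Proof.
move=> h; have [z hz zx] : chart_bump_supp a x.
  by apply: contrapT => /(chart_bump_out None) e; rewrite e ltxx in h.
have dx : cdom (c a) x by rewrite -zx; apply: cdom_cinv; exact: hr.
split=> //; first by rewrite -zx cinvK //; exact: hr.
by move=> j; rewrite /chart_bump !chart_extE // /box_bump_coord mulr1.
Qed.

Lemma chart_bump_dom_gt0 a x : chart_bump_dom a x -> 0 < chart_bump a None x.
Proof. by apply: le_lt_trans; rewrite divr_ge0 // chart_bump_ge0. Qed.

Lemma open_chart_bump_dom a : open (chart_bump_dom a).
Proof.
have -> : chart_bump_dom a = chart_bump a None @^-1` [set y | chart_bump a None a / 2 < y] by [].
apply: open_comp; last exact: open_gt.
by move=> x _; apply: (smooth_continuous (A := A)); exact: smooth_chart_bump.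
Qed.

Lemma chart_bump_dom_center a : chart_bump_dom a a.
Proof.
by rewrite /chart_bump_dom /= ltr_pdivrMr // ltr_pMr ?chart_bump_center // ltr1n.
Qed.

(** If the bump is small at [x'], its values at [x] and [x'] differ by at least [eta / 2], and
    boundedness of [H] suffices. Otherwise both points lie in the box, where [H] is Lipschitz in
    coordinates and these are quotients with denominators above [eta / 2]. *)
Lemma chart_bump_lipschitz (H : M -> R) a (BH : R) : smooth A H ->
  (forall x, `|H x| <= BH) ->
  exists2 L, 0 <= L & forall x x', chart_bump_dom a x ->
    `|H x - H x'| <= L * \sum_o `|chart_bump a o x - chart_bump a o x'|.
Proof.
move=> sH hB; set eta := chart_bump a None a / 2.
have eta0 : 0 < eta by rewrite divr_gt0 // chart_bump_center.
have BH0 : 0 <= BH by apply: le_trans (hB a).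
have [C C0 hC] := lipschitz_on_box (cimg_open (c := c a))
  (sH _ (chart_at_atlas A a)) (hr (a := a)).
have [K K0 hK] : exists2 K, 0 <= K & forall y i, bx a y -> `|y 0 i| <= K.
  exists (`|ctr a| + r a); first by rewrite addr_ge0 // ltW.
  move=> y i hy; rewrite -[y 0 i](subrK (ctr a 0 i)).
  apply: le_trans (ler_normD _ _) _; rewrite [leRHS]addrC.
  by apply: lerD; [exact: hy|exact: norm_coord].
pose S x x' := \sum_o `|chart_bump a o x - chart_bump a o x'|.
have leS o x x' : `|chart_bump a o x - chart_bump a o x'| <= S x x'.
  by rewrite /S (bigD1 o) //= lerDl sumr_ge0.
have e20 : 0 < eta / 2 by rewrite divr_gt0.
have L1 : 0 <= 2 * BH / (eta / 2) by apply: divr_ge0 (ltW e20); rewrite mulr_ge0.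
have L2 : 0 <= C * (d%:R * ((K + 1) / (eta / 2))).
  rewrite mulr_ge0 // mulr_ge0 //; apply: divr_ge0 (ltW e20).
  exact: addr_ge0.
exists (2 * BH / (eta / 2) + C * (d%:R * ((K + 1) / (eta / 2)))).
  exact: addr_ge0.
move=> x x' hx; rewrite -/(S x x') mulrDl.
have S0 : 0 <= S x x' by exact: sumr_ge0.
have [h|h] := leP (chart_bump a None x') (eta / 2).
  apply: (@le_trans _ _ (2 * BH / (eta / 2) * S x x')); last first.
    by rewrite lerDl mulr_ge0.
  apply: le_trans (ler_normB _ _) _.
  have h1 : eta / 2 <= S x x'.
    apply: le_trans (leS None x x'); apply: le_trans (ler_norm _).
    by move: hx; rewrite /chart_bump_dom /= -/eta => hx; lra.
  apply: (@le_trans _ _ (2 * BH)); first by rewrite mulr2n mulrDl mul1r lerD.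
  rewrite -mulrA ler_peMr ?mulr_ge0 //.
  by rewrite mulrC ler_pdivlMr // mul1r.
apply: (@le_trans _ _ (C * (d%:R * ((K + 1) / (eta / 2))) * S x x')); last first.
  by rewrite lerDr mulr_ge0.
have [dx bxx px] := chart_bump_gt0 (chart_bump_dom_gt0 hx).
have p'0 : 0 < chart_bump a None x' by exact: lt_trans h.
have [dx' bxx' px'] := chart_bump_gt0 p'0.
have := hC _ _ bxx' bxx; rewrite /= !cmapK // => h1; apply: le_trans h1 _.
have -> : C * (d%:R * ((K + 1) / (eta / 2))) * S x x' =
  C * (d%:R * ((K + 1) * S x x' / (eta / 2))) by ring.
apply: ler_wpM2l => //.
rewrite mulr_natl -[d in _ *+ d]card_ord -sumr_const; apply: ler_sum => i _.
set u := cmap _ x 0 i; set u' := cmap _ x' 0 i.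
set b := chart_bump a None x; set b' := chart_bump a None x' in h p'0 px' *.
have e : u - u' = ((chart_bump a (Some i) x - chart_bump a (Some i) x') + u * (b' - b)) / b'.
  by rewrite px px' -/u -/u' -/b -/b'; field; rewrite gt_eqF.
rewrite e normrM normfV (gtr0_norm p'0).
apply: (@le_trans _ _ ((K + 1) * S x x' / b')).
  rewrite ler_pM2r ?invr_gt0 //; apply: le_trans (ler_normD _ _) _.
  rewrite mulrDl mul1r addrC lerD // normrM.
  by apply: ler_pM => //; [exact: hK|rewrite distrC; exact: leS].
apply: ler_wpM2l; first by rewrite mulr_ge0 // addr_ge0.
by rewrite lef_pV2 ?posrE // ltW.
Qed.

End Embedding.

(** * Proof of the theorem *)

Lemma compact_fset_cover (T : topologicalType) (K : set T) (V : T -> set T) :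
  compact K -> (forall a, open (V a)) -> (forall a, V a a) ->
  exists D : {fset T}, forall x, K x -> exists2 a, a \in D & V a x.
Proof.
move=> /compact_near_coveringP cK oV Va.
(* The filter of sufficiently large finite sets turns near-covering compactness into a finite
   subcover. *)
pose F : set_system {fset T} :=
  filter_from [set: {fset T}] (fun D0 => [set D | (D0 `<=` D)%fset]).
have FF : Filter F.
  apply: filter_from_filter; first by exists fset0.
  move=> D1 D2 _ _; exists (D1 `|` D2)%fset => // D /=.
  by rewrite fsubUset => /andP[].
have hP x : K x -> \forall x' \near x & D \near F, exists2 a, a \in D & V a x'.
  move=> _; exists (V x, [set D | ([fset x] `<=` D)%fset]).
    split; first exact: open_nbhs_nbhs (conj (oV x) (Va x)).
    by exists [fset x]%fset.
  move=> [x' D] /= [Vx']; rewrite fsub1set => xD; by exists x.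
by have [D0 _ /(_ D0 (fsubset_refl _)) h] := cK _ F _ FF hP; exists D0.
Qed.

Section Family.
Context {R : realType} {d : nat} {M : topologicalType} (A : manifold R d M).

(* A partial Whitney embedding [x |-> (f k x)_k], defined near [K]. *)
Lemma embedding_family (K : set M) : compact K ->
  exists (I : finType) (f : I -> M -> R) (chi : M -> R),
  [/\ forall k, smooth A (f k) /\ exists2 B, 0 <= B & forall x, `|f k x| <= B,
      forall x z, K z -> rho f x z = 0 -> x = z,
      forall H, smooth A H -> (forall x, ~ K x -> H x = 0) ->
        exists2 L, 0 <= L & forall x y, `|H x - H y| <= L * rho f x y
    & [/\ smooth_compact_support A chi, forall x, 0 <= chi x &
        exists O, [/\ open O, K `<=` O & forall x, O x -> chi x = 1]]].
Proof.
move=> cK.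
have /choice[r hr0] a : exists r, 0 < r /\
    box (cmap (chart_at A a) a) r `<=` cimg (chart_at A a).
  have [r r0 hr] := open_box (cimg_open (c := chart_at A a)) (cimg_cmap (mem_chart_at A a)).
  by exists r.
have r0 a : 0 < r a by case: (hr0 a).
have hr a : box (cmap (chart_at A a) a) (r a) `<=` cimg (chart_at A a) by case: (hr0 a).
have [D hD] := compact_fset_cover cK (open_chart_bump_dom r0 hr) (chart_bump_dom_center A r0).
pose I : finType := (D * option 'I_d)%type.
pose f (k : I) : M -> R := chart_bump A r (val k.1) k.2.
have le_rho_chart_bump (a : D) x y :
    \sum_o `|chart_bump A r (val a) o x - chart_bump A r (val a) o y| <= rho f x y.
  rewrite /rho -(pair_bigA _ (fun (a : D) o =>
    `|chart_bump A r (val a) o x - chart_bump A r (val a) o y|)) /=.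
  rewrite (bigD1 a) //= lerDl sumr_ge0 // => b _; exact: sumr_ge0.
have in_dom x : K x -> exists a : D, chart_bump_dom A r (val a) x.
  by move=> /hD[a aD hx]; exists [` aD]%fset.
have sp a o : smooth A (chart_bump A r a o) by exact: smooth_chart_bump.
have pos a : 0 < chart_bump A r a None a / 2 by rewrite divr_gt0 // (chart_bump_center A r0).
(* Normalized so that a single bump already makes [W] exceed 1 on its domain. *)
pose W x := \sum_(a : D) (chart_bump A r (val a) None (val a) / 2)^-1 *
  chart_bump A r (val a) None x.
have W1 x (a : D) : chart_bump_dom A r (val a) x -> 1 < W x.
  move=> hx; apply: (@lt_le_trans _ _
    ((chart_bump A r (val a) None (val a) / 2)^-1 * chart_bump A r (val a) None x)).
    by rewrite ltr_pdivlMl ?mulr1.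
  rewrite /W (bigD1 a) //= lerDl; apply: sumr_ge0 => b _.
  by rewrite mulr_ge0 ?(chart_bump_ge0 A) // invr_ge0 ltW.
have sW : smooth A W.
  by apply: smooth_sum => a; exact: (smoothZ _ (sp _ _)).
(* A smooth step in [W], equal to 0 for [W <= 0] and to 1 for [W >= 1]; the two terms of the
   denominator never vanish together. *)
pose chi x := flat 0 (W x) / (flat 0 (W x) + flat 0 (1 - W x)).
have den x : 0 < flat 0 (W x) + flat 0 (1 - W x).
  have [w0|w0] := leP (W x) 0.
    by rewrite ltr_wpDl ?flat_ge0 // flat_gt0 //; lra.
  by rewrite ltr_pwDl ?flat_ge0 // flat_gt0.
have schi : smooth A chi.
  have s1 := smooth_flat sW; have s2 := smooth_flat (smooth_cstB 1 sW).
  apply: (smoothM s1); apply: smooth_inv; last exact: (smoothD s1 s2).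
  by move=> x; rewrite gt_eqF.
exists I, f, chi; split.
- move=> [a o]; split; first exact: sp.
  apply: (bounded_off_compact (compact_chart_bump_supp hr (a := val a))).
    by move=> x; exact: (chart_bump_out r0).
  exact: (smooth_continuous (A := A) (sp _ _)).
- move=> x z /in_dom[a hz] rho0.
  have e o : chart_bump A r (val a) o x = chart_bump A r (val a) o z.
    apply/eqP; rewrite -subr_eq0 -normr_eq0 eq_le normr_ge0 andbT -rho0.
    apply: le_trans (le_rho_chart_bump a x z).
    by rewrite (bigD1 o) //= lerDl sumr_ge0.
  have pz := chart_bump_dom_gt0 hz.
  (* Equality of the bumps forces [x] into the chart of [z], although [x] is not assumed to lie in
     [K]. *)
  have px : 0 < chart_bump A r (val a) None x by rewrite e.
  have [dz _ cz] := chart_bump_gt0 r0 hr pz.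
  have [dx _ cx] := chart_bump_gt0 r0 hr px.
  rewrite -(cmapK dz) -(cmapK dx); congr (cinv _ _).
  apply/rowP => j; have := e (Some j); rewrite cz cx e => h.
  by apply: (mulfI _ h); rewrite gt_eqF.
- move=> H sH H0.
  have [BH BH0 hBH] := bounded_off_compact cK H0 (smooth_continuous sH).
  have /choice[L hL] (a : D) : exists L, 0 <= L /\ forall x x',
      chart_bump_dom A r (val a) x ->
      `|H x - H x'| <= L * \sum_o `|chart_bump A r (val a) o x - chart_bump A r (val a) o x'|.
    by have [L L0 hL] := chart_bump_lipschitz r0 hr (val a) sH hBH; exists L.
  exists (\sum_a L a); first by apply: sumr_ge0 => a _; case: (hL a).
  have key x y : K x -> `|H x - H y| <= (\sum_a L a) * rho f x y.
    move=> /in_dom[a hx]; have [La0 /(_ x y hx) h] := hL a; apply: le_trans h _.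
    apply: (@le_trans _ _ (L a * rho f x y)); first by rewrite ler_wpM2l.
    rewrite ler_wpM2r ?rho_ge0 // (bigD1 a) //= lerDl sumr_ge0 // => b _.
    by case: (hL b).
  move=> x y; have [Kx|nKx] := pselect (K x); first exact: key.
  have [Ky|nKy] := pselect (K y); first by rewrite distrC rhoC; exact: key.
  rewrite !H0 // subrr normr0 mulr_ge0 ?rho_ge0 // sumr_ge0 // => a _.
  by case: (hL a).
- split.
  + split=> //.
    apply: (@compact_support_sub _ _ _ A (\big[setU/set0]_(a : D) chart_bump_supp A r (val a))).
      by apply: bigsetU_compact => a _; exact: compact_chart_bump_supp.
    move=> x hx; rewrite /chi flat_le0 ?mul0r // /W big1 // => a _.
    have -> : chart_bump A r (val a) None x = 0; last by rewrite mulr0.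
    apply: (chart_bump_out r0) => h; apply: hx.
    by rewrite (bigD1 a) //=; left.
  + by move=> x; rewrite divr_ge0 ?flat_ge0 // ltW.
  + exists [set x | 1 < W x]; split.
    * apply: (@open_comp _ _ W [set y | 1 < y]); last exact: open_gt.
      by move=> x _; exact: (smooth_continuous sW).
    * by move=> x /in_dom[a hx]; exact: W1 hx.
    * move=> x /= hx; have f0 : flat 0 (1 - W x) = 0 by apply: flat_le0; rewrite subr_le0 ltW.
      by rewrite /chi f0 addr0 divff // gt_eqF // flat_gt0 //; lra.
Qed.
End Family.

(** * Separation from the target beyond the critical time *)

Section Separation.
Context {R : realType} {M : topologicalType} {I : finType}.
Context (g : R -> M -> M) (f f' : I -> M -> R) (B L : R).
Context (B0 : 0 <= B) (L0 : 0 <= L)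
  (der : forall k x (t : R), is_derive t 1 (fun s => f k (g s x)) (f' k (g t x)))
  (lip : forall k x y, `|f' k x - f' k y| <= L * rho f x y)
  (g0 : forall x, g 0 x = x)
  (hB' : forall k x, `|f' k x| <= B)
  (cf : forall k, continuous (f k)).

Lemma rho_continuous z : continuous (fun x => rho f x z).
Proof.
move=> x; rewrite /rho; elim: (index_enum _) => [|k s IH].
  have -> : (fun x => \sum_(k <- [::]) `|f k x - f k z|) = cst 0.
    by apply/funext => u; rewrite big_nil.
  exact: cst_continuous.
have -> : (fun x => \sum_(j <- k :: s) `|f j x - f j z|) =
    (fun x => `|f k x - f k z|) + (fun x => \sum_(j <- s) `|f j x - f j z|).
  by apply/funext => u; rewrite big_cons.
apply: (@continuousD R) => //.
apply: (@continuous_comp _ _ _ (fun x => f k x - f k z) Num.norm); last exact: norm_continuous.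
by apply: (@continuousB R); [exact: cf|exact: cst_continuous].
Qed.

Lemma rho_time_diff x t t0 : rho f (g t x) (g t0 x) <= #|I|%:R * B * `|t - t0|.
Proof.
have := rho_time der g0 hB' (g t0 x) (t - t0).
by rewrite (rho_group L0 der lip g0) subrK.
Qed.

(** The flow is only known to be continuous in time; joint continuity is obtained after composing
    with [rho], from the explicit majorant [u] of the increment. *)
Lemma rho_flow_continuous :
  continuous (fun q : M * (R * M) => rho f (g q.2.1 q.1) q.2.2).
Proof.
move=> [x0 [t0 z0]].
pose u (q : M * (R * M)) := #|I|%:R * B * `|q.2.1 - t0| +
  (flow_lip L `|t0| (I := I) * rho f q.1 x0 + rho f q.2.2 z0).
have cu : {for (x0, (t0, z0)), continuous u}.
  apply: (@continuousD R).
    apply: continuousM; first exact: cst_continuous.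
    apply: (@continuous_comp _ _ _ (fun q : M * (R * M) => q.2.1 - t0) Num.norm);
      last exact: norm_continuous.
    apply: (@continuousB R); last exact: cst_continuous.
    apply: (@continuous_comp _ _ _ (@snd M (R * M)) fst); first exact: cvg_snd.
    exact: cvg_fst.
  apply: (@continuousD R).
    apply: continuousM; first exact: cst_continuous.
    apply: (@continuous_comp _ _ _ (@fst M (R * M)) (fun x => rho f x x0)); first exact: cvg_fst.
    exact: rho_continuous.
  apply: (@continuous_comp _ _ _ (fun q : M * (R * M) => q.2.2) (fun x => rho f x z0)).
    apply: (@continuous_comp _ _ _ (@snd M (R * M)) snd); first exact: cvg_snd.
    exact: cvg_snd.
  exact: rho_continuous.
have u0 : u (x0, (t0, z0)) = 0.
  by rewrite /u /= subrr normr0 mulr0 !rhoxx mulr0 !addr0.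
apply/cvgrPdist_le => e e0; move/cvgrPdist_le : cu => /(_ e e0).
apply: filterS => -[x [t z]]; rewrite u0 sub0r normrN => hu.
apply: le_trans hu; apply: le_trans (ler_norm _); rewrite /u /=.
have h1 := rho_time_diff x t t0.
have h2 := rho_flow L0 der lip g0 (T := `|t0|) x x0 (lexx `|t0|).
have a1 := rho_triangle f (g t x) (g t0 x0) z0.
have a2 := rho_triangle f (g t0 x) (g t x) (g t0 x0).
have a3 := rho_triangle f z (g t x) z0.
have b1 := rho_triangle f (g t0 x0) (g t x) z.
have b3 := rho_triangle f z0 (g t0 x0) z.
have c1 := rhoC f (g t x) (g t0 x0); have c2 := rhoC f z0 z.
have c3 := rhoC f (g t0 x) (g t x).
rewrite ler_norml; apply/andP; split; lra.
Qed.

Lemma separation (X0 X1 : set M) (tau : R) : 0 < tau -> compact X0 -> compact X1 ->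
  (forall x t z, X0 x -> `|t| <= tau -> X1 z -> rho f (g t x) z != 0) ->
  exists T eta, [/\ tau < T, 0 < eta & forall x t z, X0 x -> `|t| <= T -> X1 z ->
    eta <= rho f (g t x) z].
Proof.
move=> tau0 cX0 cX1 hne.
pose K : set (M * (R * M)) := X0 `*` (`[- tau, tau]%classic `*` X1).
have cK : compact K.
  apply: compact_setX => //; apply: compact_setX => //; exact: segment_compact.
have itvE t : `[- tau, tau]%classic t <-> `|t| <= tau.
  by rewrite /= in_itv /= ler_norml.
have [m m0 hm] : exists2 m, 0 < m & forall x t z, X0 x -> `|t| <= tau -> X1 z ->
    m <= rho f (g t x) z.
  have [K0|/nonemptyPn K0] := pselect (K !=set0); last first.
    exists 1 => // x t z hx ht hz; suff : K (x, (t, z)) by rewrite K0.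
    by split=> //; split=> //; exact/itvE.
  have cK' := continuous_subspaceT (A := K) rho_flow_continuous.
  have [[x [t z]] + hmin] := compact_EVT_min K0 cK cK'.
  move=> /set_mem[/= hx [/= /itvE ht hz]].
  exists (rho f (g t x) z); first by rewrite lt0r rho_ge0 hne.
  move=> x' t' z' hx' ht' hz'; apply: (hmin (x', (t', z'))).
  by apply: mem_set; split=> //; split=> //; exact/itvE.
(* Within time [s] a trajectory moves by at most half of the minimum [m], so the separation survives
   up to [tau + s]. *)
have [s [s0 _ hs]] := @pos_small R (#|I|%:R * B) (m / 2)
  (mulr_ge0 (ler0n _ _) B0) (divr_gt0 m0 (ltr0Sn _ 1)).
exists (tau + s), (m / 2); split; rewrite ?ltrDl ?divr_gt0 //.
move=> x t z hx ht hz.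
have [t' ht' htt'] : exists2 t', `|t'| <= tau & `|t - t'| <= s.
  have [h|h] := leP `|t| tau.
    by exists t => //; rewrite subrr normr0 ltW.
  have [tp|tn] := leP 0 t.
    exists tau; first by rewrite gtr0_norm.
    by move: h ht; rewrite ger0_norm // => h ht; rewrite ger0_norm; lra.
  exists (- tau); first by rewrite normrN gtr0_norm.
  by move: h ht; rewrite ltr0_norm // => h ht; rewrite ler0_norm; lra.
have h1 := hm x t' z hx ht' hz.
have h2 := rho_triangle f (g t x) (g t' x) z.
have h3 := rho_time_diff x t t'.
have h4 : #|I|%:R * B * `|t - t'| <= m / 2.
  by apply: le_trans hs; rewrite ler_wpM2l // mulr_ge0.
rewrite (rhoC f (g t' x) (g t x)) in h2; lra.
Qed.

End Separation.

Theorem theorem1p10 (R : realType) (d : nat) (M : topologicalType)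
    (A : manifold R d M) (w : @bilin_field R d M) (hw : symplectic A w)
    (hM : connected [set: M])
    (X0 X1 Y0 Y1 : set M)
    (hX0 : compact X0) (hX1 : compact X1)
    (hY0 : compact Y0) (hY1 : compact Y1)
    (hX : X0 `&` X1 = set0) (hY : Y0 `&` Y1 = set0)
    (p : R) (hp : 0 < p) (hpb : pb4 A w X0 X1 Y0 Y1 = p%:E)
    (G : M -> R) (hG : smooth_compact_support A G)
    (hG0 : forall x, Y0 x -> G x <= 0) (hG1 : forall x, Y1 x -> 1 <= G x)
    (g : R -> M -> M) (hg : is_flow A (sgrad A w G) g) :
  exists (x : M) (T : R), [/\ X0 x, - (1 / p) <= T <= 1 / p & X1 (g T x)].
Proof.
apply: contrapT => hno.
(* The norm is a supremum, so a uniform bound [q < p] is required. *)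
suff [F [q [hF hF0 hF1 hq Fq]]] : exists F q,
    [/\ smooth_compact_support A F, forall x, X0 x -> F x <= 0,
      forall x, X1 x -> 1 <= F x, q < p & forall x, `|poisson A w F G x| <= q].
  have h1 : (pb4 A w X0 X1 Y0 Y1 <= unorm (poisson A w F G))%E.
    by apply: ereal_inf_lbound; exists F, G.
  have h2 : (unorm (poisson A w F G) <= q%:E)%E.
    by apply: ge_ereal_sup => _ [x _ <-]; rewrite lee_fin.
  have := le_trans h1 h2; rewrite hpb lee_fin => h3.
  by have := le_lt_trans h3 hq; rewrite ltxx.
have [sG cG] := hG.
set S := closure [set x | G x != 0] in cG.
have GS x : ~ S x -> exists U, [/\ open U, U x & forall z, U z -> G z = 0].
  move=> nSx; exists (~` S); split=> //.
    exact: closed_openC (@closed_closure _ _).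
  by move=> z /= nSz; apply/eqP/negPn/negP => Gz; apply: nSz; exact: subset_closure.
have P0 F x : smooth A F -> ~ S x -> poisson A w F G x = 0.
  by move=> sF /GS[U [oU Ux hU]]; exact: (poisson_eq0 hw sF sG oU Ux hU).
(* [S] is included so that the velocities [f' k], which vanish off it, are Lipschitz for [rho]; [X1]
   so that [rho] separates its points from all others. *)
pose K := S `|` X1.
have cK : compact K by exact: compactU.
have [I [f [chi [hf hsep hlip [hchi chi0 [U [oU KU chi1]]]]]]] := embedding_family A cK.
have sf k : smooth A (f k) by case: (hf k).
pose f' k := poisson A w (f k) G.
have sf' k : smooth A (f' k) := smooth_poisson hw (sf k) sG.
have f'0 k x : ~ K x -> f' k x = 0.
  by move=> nK; apply: (P0 _ _ (sf k)) => Sx; apply: nK; left.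
have flowF F x (t : R) : smooth A F ->
    is_derive t 1 (fun s => F (g s x)) (poisson A w F G (g t x)).
  by move=> sF; rewrite (poissonE hw) //; exact: flow_derive.
have g0 x : g 0 x = x by case: (hg x).
have /choice[Bf hBf] k : exists B, 0 <= B /\ forall x, `|f k x| <= B.
  by have [_ [B B0 hB]] := hf k; exists B.
have /choice[Bf' hBf'] k : exists B, 0 <= B /\ forall x, `|f' k x| <= B.
  have [B B0 hB] := bounded_off_compact cK (f'0 k) (smooth_continuous (sf' k)).
  by exists B.
have /choice[Lk hLk] k : exists L, 0 <= L /\ forall x y, `|f' k x - f' k y| <= L * rho f x y.
  by have [L L0 hL] := hlip _ (sf' k) (f'0 k); exists L.
pose B := \sum_k (Bf k + Bf' k); pose L := \sum_k Lk k.
have B0 : 0 <= B by apply: sumr_ge0 => k _; rewrite addr_ge0 //; [case: (hBf k)|case: (hBf' k)].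
have L0 : 0 <= L by apply: sumr_ge0 => k _; case: (hLk k).
have leB k : Bf k + Bf' k <= B.
  rewrite /B (bigD1 k) //= lerDl sumr_ge0 // => j _.
  by rewrite addr_ge0 //; [case: (hBf j)|case: (hBf' j)].
have hB k x : `|f k x| <= B.
  have [_ /(_ x) h] := hBf k; have [h' _] := hBf' k.
  by apply: le_trans (leB k); apply: le_trans h _; rewrite lerDl.
have hB' k x : `|f' k x| <= B.
  have [_ /(_ x) h] := hBf' k; have [h' _] := hBf k.
  by apply: le_trans (leB k); apply: le_trans h _; rewrite lerDr.
have lip k x y : `|f' k x - f' k y| <= L * rho f x y.
  have [_ /(_ x y) h] := hLk k; apply: le_trans h _.
  rewrite ler_wpM2r ?rho_ge0 // /L (bigD1 k) //= lerDl sumr_ge0 // => j _.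
  by case: (hLk j).
have der k x (t : R) : is_derive t 1 (fun s => f k (g s x)) (f' k (g t x)).
  exact: (flowF _ x t (sf k)).
have p1 : 0 < 1 / p by rewrite divr_gt0.
have hne x t z : X0 x -> `|t| <= 1 / p -> X1 z -> rho f (g t x) z != 0.
  move=> hx ht hz; apply/eqP => /(hsep _ _ (or_intror hz)) e; apply: hno.
  by exists x, t; rewrite e -ler_norml.
have [T [eta [hT eta0 heta]]] :=
  separation B0 L0 der lip g0 hB' (fun k => smooth_continuous (sf k)) p1 hX0 hX1 hne.
have T0 : 0 < T by exact: lt_trans hT.
(* With the constant [eta^-1], missing [X1] by [eta] costs 1. *)
pose V := value g f X1 T eta^-1.
have C0 : 0 <= eta^-1 by rewrite invr_ge0 ltW.
have Tp : T^-1 < p by rewrite invf_plt ?posrE // -div1r.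
(* The final slope [(T^-1 + e') / (1 - 2 e')] is below [p] exactly when [e' (1 + 2 p) < p - T^-1],
   given that [1 - 2 e'] is positive. *)
have [e [e0 e1 he]] := @pos_small R (1 + 2 * p) ((p - T^-1) / 2)
  (addr_ge0 ler01 (mulr_ge0 (ler0n _ _) (ltW hp)))
  (divr_gt0 (etrans (subr_gt0 _ _) Tp) (ltr0Sn _ 1)).
pose e' := e / 4.
have e'0 : 0 < e' by rewrite divr_gt0.
have r0 : 0 <= T^-1 by rewrite invr_ge0 ltW.
(* The net needs a point [x0]; on an empty manifold every condition on [F] is vacuous. *)
have [[x0 _]|nM] := pselect ([set: M] !=set0); last first.
  exists chi, 0; split=> //.
  - by move=> x _; case: nM; exists x.
  - by move=> x _; case: nM; exists x.
  - by move=> x; case: nM; exists x.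
have L10 : 0 <= eta^-1 * flow_lip L T (I := I) by rewrite mulr_ge0 // flow_lip_ge0.
have V_flow s x : V (g s x) <= V x + T^-1 * `|s|.
  by rewrite mulrC; exact: (value_flow X1 L0 T0 C0 der lip g0).
have V_lip x y := value_lip X1 L0 T0 C0 der lip g0 x y.
have [J [j0 [lam [eps [a [y [lam0 eps0 hV hD]]]]]]] :=
  smoothing B0 L0 der lip g0 hB hB' r0 L10 V_flow V_lip x0 e'0.
set h := softmin f lam eps a y in hV hD.
have sh : smooth A h by exact: smooth_softmin.
have k0 : 0 < 1 - 2 * e' by rewrite /e'; lra.
(* [V] is at least 1 on [X0] and at most 0 on [X1], and [h] is within [e'] of it. Hence [1 - e' - h]
   is at most 0 on [X0] and at least [1 - 2 e'] on [X1], which fixes the scaling. *)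
pose F x := chi x * ((1 - 2 * e')^-1 * (1 - e' - h x)).
have sF : smooth A F.
  by have [schi _] := hchi; exact: (smoothM schi (smoothZ _ (smooth_cstB _ sh))).
exists F, ((T^-1 + e') / (1 - 2 * e')); split.
- split=> //; have [_ cchi] := hchi.
  apply: (compact_support_sub A cchi) => x nx.
  rewrite /F; have -> : chi x = 0; last by rewrite mul0r.
  by apply/eqP/negPn/negP => hx; apply: nx; exact: subset_closure.
- move=> x hx; rewrite mulr_ge0_le0 // mulr_ge0_le0 ?invr_ge0 ?(ltW k0) //.
  have V1 : 1 <= V x.
    apply: value_far => // t z ht hz.
    by rewrite ler_pdivlMl // mulr1; exact: heta.
  by have /andP[h1 _] := hV x; lra.
- move=> x hx; have -> : F x = (1 - 2 * e')^-1 * (1 - e' - h x).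
    by rewrite /F chi1 ?mul1r //; apply: KU; right.
  have V0 : V x <= 0 by exact: value_target.
  by rewrite ler_pdivlMl // mulr1; have /andP[_ h1] := hV x; lra.
- rewrite ltr_pdivrMr // /e'.
  have : e + 2 * p * e <= (p - T^-1) / 2 by move: he; rewrite mulrDl mul1r.
  have : 0 <= p * e by rewrite mulr_ge0 // ltW.
  nra.
- move=> x; have [Sx|nSx] := pselect (S x); last first.
    rewrite P0 // normr0; apply: divr_ge0 (ltW k0).
    by rewrite addr_ge0 // ltW.
  have [D hD1 hD2] := hD x.
  have dF := flowF F x 0 sF; rewrite g0 in dF.
  have dF' : is_derive (0 : R) 1 (fun s => F (g s x)) (- ((1 - 2 * e')^-1 * D)).
    (* For short times the trajectory stays in the open set where [chi] is 1, so [F] is affine in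
       [h] along it. *)
    have near1 : \forall s \near (0 : R),
        (1 - 2 * e')^-1 * (1 - e' - h (g s x)) = F (g s x).
      have [_ cg _] := hg x.
      have : \forall s \near (0 : R), U (g s x).
        apply: (cg 0); apply: open_nbhs_nbhs; split=> //.
        by rewrite g0; apply: KU; left.
      by apply: filterS => s Us; rewrite /F chi1 // mul1r.
    apply: (near_eq_is_derive near1).
    exact: is_derive_affine.
  have <- : - ((1 - 2 * e')^-1 * D) = poisson A w F G x.
    by rewrite -(@derive_val _ _ _ _ _ _ _ dF) -(@derive_val _ _ _ _ _ _ _ dF').
  rewrite normrN normrM gtr0_norm ?invr_gt0 // mulrC ler_wpM2r //.
  by rewrite invr_ge0 ltW.
Qed.
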